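(* Let $M$ be a catenoid of $\mathbf{L}^3$ with rotation axis $(0,0,1)$ or $(1,0,0)$. Then its dual surface $M^\sharp$ is the Euclidean catenoid with the same rotational axis. The dual surface of the parabolic catenoid of axis $(1,0,1)$ is the Enneper surface.
   Context: $\mathbf{E}^3$ and $\mathbf{L}^3$ denote $\mathbb{R}^3$ with the metric $dx^2+dy^2+\epsilon\,dz^2$, with $\epsilon=1$ and $\epsilon=-1$ respectively. A (conformal) minimal surface of $\mathbf{E}^3$ ($\epsilon=1$) or maximal surface of $\mathbf{L}^3$ ($\epsilon=-1$) is given on a simply-connected domain $\Omega\subset\mathbb{C}$ by $X(z)=X(z_0)+\Re\int_{z_0}^z\phi(w)\,dw$, where the isotropic curve $\phi=2\,\partial X/\partial z:\Omega\to\mathbb{C}^3$ is holomorphic, $\phi_1^2+\phi_2^2+\epsilon\phi_3^2=0$ and $|\phi_1|^2+|\phi_2|^2+\epsilon|\phi_3|^2\not\equiv 0$ (the induced metric may degenerate at some points). Its Weierstrass representation is $(g,\omega)$ with $g=\phi_3/(\phi_1-i\phi_2)$, $\omega=(\phi_1-i\phi_2)dz$, so that $\phi\,dz=\left(\tfrac12(1-\epsilon g^2)\omega,\tfrac i2(1+\epsilon g^2)\omega,g\omega\right)$. Dual surface: if $M$ is maximal in $\mathbf{L}^3$ with isotropic curve $\psi$, then $M^\sharp$ is the minimal surface of $\mathbf{E}^3$ with isotropic curve $(i\psi_1,i\psi_2,\psi_3)$; it is defined up to translations, and surfaces are identified up to reparametrization, orientation-preserving isometries and dilations of the ambient space (for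 ''the same axis'', the identification is up to translations and dilations, i.e. the axis is a line with the same direction). The catenoids of $\mathbf{L}^3$ are the nonplanar rotational maximal surfaces. With axis in the direction $(0,0,1)$ (timelike), $(1,0,0)$ (spacelike), $(1,0,1)$ (lightlike) they are called elliptic, hyperbolic and parabolic catenoid; each is unique up to dilations and rigid motions, and can be given on $\mathbb{C}$ by the Weierstrass data: elliptic: $g=e^z$, $\omega=e^{-z}dz$; hyperbolic: $g=i\frac{e^z-1}{e^z+1}$, $\omega=-i\frac{(e^z+1)^2}{2e^z}dz$; parabolic: $g=\frac{z}{z-2i}$, $\omega=\frac{i(z-2i)^2}{2}dz$. The rotations about $(1,0,1)$ are $$P_\theta=\begin{pmatrix}1-\frac{\theta^2}{2}&\theta&\frac{\theta^2}{2}\\-\theta&1&\theta\\-\frac{\theta^2}{2}&\theta&1+\frac{\theta^2}{2}\end{pmatrix}.$$ The Euclidean catenoid with axis $(0,0,1)$ is the minimal surface of $\mathbf{E}^3$ with $g=e^z$, $\omega=e^{-z}dz$ on $\mathbb{C}$ (parametrizing its universal cover); the Enneper surface is the minimal surface with $g=z$, $\omega=dz$ on $\mathbb{C}$. *)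

(* Defs.v *)
From Stdlib Require Import Reals.
From Coquelicot Require Import Coquelicot.
Open Scope R_scope.

Record vec3 (T : Type) : Type := V3 { c1 : T; c2 : T; c3 : T }.
Arguments V3 {T} _ _ _.
Arguments c1 {T} _.
Arguments c2 {T} _.
Arguments c3 {T} _.

Notation R3 := (vec3 R).
Notation C3 := (vec3 C).

Definition add3 (p q : R3) : R3 := V3 (c1 p + c1 q) (c2 p + c2 q) (c3 p + c3 q).
Definition sub3 (p q : R3) : R3 := V3 (c1 p - c1 q) (c2 p - c2 q) (c3 p - c3 q).
Definition scal3 (r : R) (p : R3) : R3 := V3 (r * c1 p) (r * c2 p) (r * c3 p).
Definition dot3 (p q : R3) : R := c1 p * c1 q + c2 p * c2 q + c3 p * c3 q.
Definition zero3 : R3 := V3 0 0 0.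
Definition e1 : R3 := V3 1 0 0.
Definition e2 : R3 := V3 0 1 0.
Definition e3 : R3 := V3 0 0 1.
Definition det3 (a b c : R3) : R :=
  c1 a * (c2 b * c3 c - c3 b * c2 c)
  - c2 a * (c1 b * c3 c - c3 b * c1 c)
  + c3 a * (c1 b * c2 c - c2 b * c1 c).

(* Preservation of the inner product forces [A] to be linear. *)
Definition euclidean_rotation (A : R3 -> R3) : Prop :=
  (forall p q, dot3 (A p) (A q) = dot3 p q) /\ det3 (A e1) (A e2) (A e3) = 1.

Definition Cexp (z : C) : C := (exp (Re z) * cos (Im z), exp (Re z) * sin (Im z)).

Definition plane : C -> Prop := fun _ => True.

Definition holomorphic_on (D : C -> Prop) (f : C -> C) : Prop :=
  forall z, D z -> @ex_derive C_AbsRing C_NormedModule f z.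

Definition antiholomorphic_on (D : C -> Prop) (f : C -> C) : Prop :=
  holomorphic_on D (fun z => Cconj (f z)).

(* Paths, loops and homotopies are functions on the whole of [R] or [R * R],
   of which only the restriction to [0,1] or to its square matters: a continuous
   function on a closed interval or square always has a continuous extension. *)
Definition path_connected (D : C -> Prop) : Prop :=
  forall z w, D z -> D w ->
  exists g : R -> C,
    (forall t, continuous g t) /\ (forall t, 0 <= t <= 1 -> D (g t)) /\
    g 0 = z /\ g 1 = w.

Definition loops_contractible (D : C -> Prop) : Prop :=
  forall g : R -> C,
    (forall t, continuous g t) -> (forall t, 0 <= t <= 1 -> D (g t)) ->
    g 0 = g 1 ->
  exists (H : R * R -> C) (w : C),
    (forall st, continuous H st) /\
    (forall s t, 0 <= s <= 1 -> 0 <= t <= 1 -> D (H (s, t))) /\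
    (forall t, 0 <= t <= 1 -> H (0, t) = g t) /\
    (forall t, 0 <= t <= 1 -> H (1, t) = w) /\
    (forall s, 0 <= s <= 1 -> H (s, 0) = H (s, 1)).

Definition simply_connected_domain (D : C -> Prop) : Prop :=
  open D /\ (exists z, D z) /\ path_connected D /\ loops_contractible D.

(* Only the values of [pos] on [dom] are meaningful. *)
Record surface : Type := Surface { dom : C -> Prop; pos : C -> R3 }.

(* [2 * df/dz = w] at [z], where [2 * d/dz = d/dx - i d/dy]. *)
Definition is_twice_dz (f : C -> R) (z w : C) : Prop :=
  is_derive (fun x : R => f (x, Im z)) (Re z) (Re w) /\
  is_derive (fun y : R => f (Re z, y)) (Im z) (- Im w).

Definition is_isotropic_curve (M : surface) (phi : C -> C3) : Prop :=
  forall z, dom M z ->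
    is_twice_dz (fun u => c1 (pos M u)) z (c1 (phi z)) /\
    is_twice_dz (fun u => c2 (pos M u)) z (c2 (phi z)) /\
    is_twice_dz (fun u => c3 (pos M u)) z (c3 (phi z)).

(* [eps = 1] is the Euclidean space, [eps = -1] the Lorentzian one. *)
Definition conformal_extremal (eps : R) (M : surface) (phi : C -> C3) : Prop :=
  simply_connected_domain (dom M) /\
  is_isotropic_curve M phi /\
  holomorphic_on (dom M) (fun z => c1 (phi z)) /\
  holomorphic_on (dom M) (fun z => c2 (phi z)) /\
  holomorphic_on (dom M) (fun z => c3 (phi z)) /\
  (forall z, dom M z ->
    (c1 (phi z) * c1 (phi z) + c2 (phi z) * c2 (phi z)
     + RtoC eps * (c3 (phi z) * c3 (phi z)))%C = RtoC 0) /\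
  (exists z, dom M z /\
    Cmod (c1 (phi z)) ^ 2 + Cmod (c2 (phi z)) ^ 2
    + eps * Cmod (c3 (phi z)) ^ 2 <> 0).

Definition minimal_with (M : surface) (phi : C -> C3) : Prop := conformal_extremal 1 M phi.
Definition maximal_with (M : surface) (phi : C -> C3) : Prop := conformal_extremal (-1) M phi.

Definition weierstrass (eps : R) (g w : C -> C) (z : C) : C3 :=
  V3 (RtoC (1 / 2) * (1 - RtoC eps * (g z * g z)) * w z)%C
     (Ci * RtoC (1 / 2) * (1 + RtoC eps * (g z * g z)) * w z)%C
     (g z * w z)%C.

Definition dual_curve (psi : C -> C3) (z : C) : C3 :=
  V3 (Ci * c1 (psi z))%C (Ci * c2 (psi z))%C (c3 (psi z)).

Definition is_dual (M M' : surface) : Prop :=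
  (forall z, dom M' z <-> dom M z) /\
  exists psi, maximal_with M psi /\ minimal_with M' (dual_curve psi).

(* Conformal surfaces carry no preferred orientation, so a change of conformal
   parameter may reverse the orientation of the parameter domain. *)
Definition reparametrization (D D' : C -> Prop) (h : C -> C) : Prop :=
  exists k : C -> C,
    (forall z, D z -> D' (h z) /\ k (h z) = z) /\
    (forall w, D' w -> D (k w) /\ h (k w) = w) /\
    ((holomorphic_on D h /\ holomorphic_on D' k) \/
     (antiholomorphic_on D h /\ antiholomorphic_on D' k)).

(* [N] is [S] up to reparametrization, translation and dilation, after applying
   the linear map [A] to [S]. *)
Definition same_surface_via (A : R3 -> R3) (N S : surface) : Prop :=
  exists (h : C -> C) (lambda : R) (t : R3),
    reparametrization (dom N) (dom S) h /\ 0 < lambda /\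
    forall z, dom N z -> pos N z = add3 (scal3 lambda (A (pos S (h z)))) t.

Definition minimal_on_plane (g w : C -> C) (S : surface) : Prop :=
  (forall z, dom S z <-> plane z) /\ minimal_with S (weierstrass 1 g w).

Definition standard_catenoid (S : surface) : Prop :=
  minimal_on_plane Cexp (fun z => Cexp (- z)%C) S.

Definition standard_enneper (S : surface) : Prop :=
  minimal_on_plane (fun z => z) (fun _ => RtoC 1) S.

(* [v] is a unit vector; the axis is a line of direction [v]. *)
Definition euclidean_catenoid (v : R3) (N : surface) : Prop :=
  exists (S : surface) (A : R3 -> R3),
    standard_catenoid S /\ euclidean_rotation A /\ A e3 = v /\
    same_surface_via A N S.

Definition enneper_surface (N : surface) : Prop :=
  exists (S : surface) (A : R3 -> R3),
    standard_enneper S /\ euclidean_rotation A /\ same_surface_via A N S.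

Inductive axis : Type := Elliptic | Hyperbolic | Parabolic.

Definition axis_dir (a : axis) : R3 :=
  match a with
  | Elliptic => V3 0 0 1
  | Hyperbolic => V3 1 0 0
  | Parabolic => V3 1 0 1
  end.

(* The one-parameter group of linear isometries of Lorentz space fixing
   [axis_dir a]. *)
Definition lorentz_rotation (a : axis) (th : R) (p : R3) : R3 :=
  let (x, y, z) := p in
  match a with
  | Elliptic => V3 (cos th * x - sin th * y) (sin th * x + cos th * y) z
  | Hyperbolic => V3 x (cosh th * y + sinh th * z) (sinh th * y + cosh th * z)
  | Parabolic =>
      V3 ((1 - th ^ 2 / 2) * x + th * y + th ^ 2 / 2 * z)
         (- th * x + y + th * z)
         (- (th ^ 2 / 2) * x + th * y + (1 + th ^ 2 / 2) * z)
  end.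

(* A surface of revolution about the line [p + R v], [v = axis_dir a], in its
   isothermal parameters: the rotations about that line act as the real
   translations of a conformal parameter. This parameter ranges over the whole
   plane, i.e. the surface is entire, given on its universal cover, and not a
   rotationally invariant piece (a strip) of a larger one. *)
Definition rotational (a : axis) (M : surface) : Prop :=
  exists (h : C -> C) (p : R3),
    reparametrization plane (dom M) h /\
    forall (z : C) (th : R),
      pos M (h (z + RtoC th)%C)
      = add3 p (lorentz_rotation a th (sub3 (pos M (h z)) p)).

Definition planar (M : surface) : Prop :=
  exists (n : R3) (d : R), n <> zero3 /\ forall z, dom M z -> dot3 n (pos M z) = d.

Definition lorentz_catenoid (a : axis) (M : surface) : Prop :=
  (exists psi, maximal_with M psi) /\ ~ planar M /\ rotational a M.

(* Main.v *)
(** An invariant surface is a harmonic map of the plane whose isotropic curve [phi]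
satisfies [phi (z + t) = L_t (phi z)] for real [t], [L_t] being the rotations. Local
complex primitives of [phi] then satisfy the same identity up to an additive constant
depending only on [t], and differentiating it at [t = 0] gives the linear equation
[phi' = L'_0 phi], in particular the holomorphy of [phi], without Cauchy's integral
formula: only Goursat's theorem is needed, to get the primitives from the isotropic
curve on the given domain. Solving the equation under the isotropy condition gives
[phi] in closed form, up to a real factor and a change of parameter; the primitive of
its dual is a rotated, scaled copy of the standard catenoid or Enneper surface, and any
dual surface differs from it by a translation. *)

From Stdlib Require Import Reals Lra Psatz.
From Coquelicot Require Import Coquelicot.
Require Import Defs.
Open Scope R_scope.

(** * Complex differentiability *)

(** Holomorphic means complex differentiable once. The isotropic curve in the rotation parameter is
    [h' * psi (h z)], and nothing is known at first about the regularity of the factor [h']; local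
    primitives, in contrast, compose with [h]. This is why the differential equation is derived from
    primitives. In each case one linear coordinate is invariant under the rotations, namely [x3],
    [x1] or [x3 - x1]: the Lorentz product with the axis direction, up to sign. The matching
    component of the curve is constant by the differential equation, purely imaginary because the
    coordinate does not vary along real translations, and nonzero because the surface is not planar.
    So it equals [i s] with [s] real. The reality of [s] is what makes the dual a catenoid and not
    another member of its associate family, such as the helicoid. The sign of [s] stays free; a
    negative factor is absorbed by an antiholomorphic change of parameter for the catenoid, and by
    the parameter [i w] with another rotation for Enneper's surface. *)

Notation is_cderive := (@is_derive C_AbsRing C_NormedModule).

(** The two module structures on the target have the same norm and scalar action, so the domination
    clauses coincide and only linearity is proved again. The product and chain rules are stated for
    the second structure. *)
Lemma is_cderive_absring (f : C -> C) (z l : C) :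
  is_cderive f z l <-> @is_derive C_AbsRing (AbsRing_NormedModule C_AbsRing) f z l.
Proof.
  split; intros [_ H]; (split; [apply is_linear_scal_l | exact H]).
Qed.

Lemma is_cderive_mult (f g : C -> C) (z df dg : C) :
  is_cderive f z df -> is_cderive g z dg ->
  is_cderive (fun w => f w * g w)%C z (df * g z + f z * dg)%C.
Proof.
  intros Hf Hg.
  apply is_cderive_absring in Hf; apply is_cderive_absring in Hg.
  apply is_cderive_absring.
  exact (is_derive_mult (K := C_AbsRing) f g z df dg Hf Hg Cmult_comm).
Qed.

Lemma is_cderive_comp (f g : C -> C) (z df dg : C) :
  is_cderive f (g z) df -> is_cderive g z dg ->
  is_cderive (fun w => f (g w)) z (dg * df)%C.
Proof.
  intros Hf Hg.
  apply is_cderive_absring in Hg.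
  exact (is_derive_comp (K := C_AbsRing) (V := C_NormedModule) f g z df dg Hf Hg).
Qed.

Lemma is_cderive_eps (f : C -> C) (z l : C) :
  is_cderive f z l <->
  forall eps : posreal, exists d : posreal, forall w : C,
    Rabs (Re w - Re z) < d -> Rabs (Im w - Im z) < d ->
    Cmod (f w - f z - (w - z) * l)%C <= eps * Cmod (w - z)%C.
Proof.
  split.
  - intros [_ H] eps.
    destruct (proj2 (locally_C z _) (H z (fun P HP => HP) eps)) as [d Hd].
    exists d. intros w Hr Hi.
    apply (Hd w). split; assumption.
  - intros H. split.
    + apply (is_linear_scal_l (K := C_AbsRing) (V := C_NormedModule)).
    + intros x Hx eps.
      apply (is_filter_lim_locally_unique (K := C_AbsRing) (V:=AbsRing_NormedModule C_AbsRing)) in Hx.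
      subst x.
      destruct (H eps) as [d Hd].
      apply (proj1 (locally_C z _)). exists d. intros w [Hr Hi].
      apply (Hd w Hr Hi).
Qed.

(** The Cauchy-Riemann equations: multiplication by [p + i q] has the real matrix with rows
    [(p, - q)] and [(q, p)]. *)
Lemma is_cderive_differentiable (f : C -> C) (z l : C) :
  is_cderive f z l <->
  differentiable_pt_lim (fun x y => Re (f (x, y))) (Re z) (Im z) (Re l) (- Im l) /\
  differentiable_pt_lim (fun x y => Im (f (x, y))) (Re z) (Im z) (Im l) (Re l).
Proof.
  destruct z as [x y], l as [p q]; simpl (Re (_, _)); simpl (Im (_, _)).
  (* [Cmod] is at most [sqrt 2] times the maximum norm used by [differentiable_pt_lim]; rounding
     this factor up to 2 explains [e / 2] in both directions. *)
  assert (Hs : sqrt 2 <= 2).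
  { rewrite <- (sqrt_square 2) at 2 by lra. apply sqrt_le_1_alt. lra. }
  rewrite is_cderive_eps. split.
  - intros H.
    assert (H' : forall eps : posreal, exists d : posreal, forall u v,
      Rabs (u - x) < d -> Rabs (v - y) < d ->
      Cmod (f (u, v) - f (x, y) - ((u, v) - (x, y)) * (p, q))%C
        <= eps * Rmax (Rabs (u - x)) (Rabs (v - y))).
    { intros [e He].
      destruct (H (mkposreal (e / 2) ltac:(lra))) as [d Hd].
      exists d. intros u v Hu Hv.
      eapply Rle_trans; [apply (Hd (u, v) Hu Hv)|]; simpl.
      pose proof (Cmod_2Rmax ((u, v) - (x, y))%C) as Hc. simpl in Hc.
      assert (0 <= Rmax (Rabs (u - x)) (Rabs (v - y)))
        by (eapply Rle_trans; [apply Rabs_pos | apply Rmax_l]).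
      fold (Rminus u x) in Hc. fold (Rminus v y) in Hc.
      replace (e * Rmax (Rabs (u - x)) (Rabs (v - y)))
        with (e / 2 * (2 * Rmax (Rabs (u - x)) (Rabs (v - y)))) by field.
      apply Rmult_le_compat_l; [lra|].
      eapply Rle_trans; [exact Hc|]. apply Rmult_le_compat_r; lra. }
    split; intros eps; destruct (H' eps) as [d Hd]; exists d; intros u v Hu Hv;
      (eapply Rle_trans; [|apply (Hd u v Hu Hv)]);
      (eapply Rle_trans; [|apply Rmax_Cmod]).
    + eapply Rle_trans; [|apply Rmax_l]. apply Req_le, f_equal.
      destruct (f (u, v)), (f (x, y)); simpl; ring.
    + eapply Rle_trans; [|apply Rmax_r]. apply Req_le, f_equal.
      destruct (f (u, v)), (f (x, y)); simpl; ring.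
  - intros [H1 H2] [e He].
    destruct (H1 (mkposreal (e / 2) ltac:(lra))) as [d1 Hd1].
    destruct (H2 (mkposreal (e / 2) ltac:(lra))) as [d2 Hd2].
    exists (mkposreal (Rmin d1 d2) ltac:(apply Rmin_glb_lt; apply cond_pos)).
    intros [u v]; simpl. intros Hu Hv.
    specialize (Hd1 u v (Rlt_le_trans _ _ _ Hu (Rmin_l _ _))
                        (Rlt_le_trans _ _ _ Hv (Rmin_l _ _))).
    specialize (Hd2 u v (Rlt_le_trans _ _ _ Hu (Rmin_r _ _))
                        (Rlt_le_trans _ _ _ Hv (Rmin_r _ _))).
    simpl in Hd1, Hd2.
    pose proof (Rmax_Cmod ((u, v) - (x, y))%C) as Hc; simpl in Hc.
    fold (Rminus u x) in Hc; fold (Rminus v y) in Hc.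
    set (m := Rmax _ _) in *.
    eapply Rle_trans; [apply Cmod_2Rmax|].
    set (w := (f (u, v) - f (x, y) - ((u, v) - (x, y)) * (p, q))%C).
    assert (Hw : Rmax (Rabs (fst w)) (Rabs (snd w)) <= e / 2 * m).
    { apply Rmax_lub; unfold w.
      - eapply Rle_trans; [|exact Hd1]. apply Req_le, f_equal.
        destruct (f (u, v)), (f (x, y)); simpl; ring.
      - eapply Rle_trans; [|exact Hd2]. apply Req_le, f_equal.
        destruct (f (u, v)), (f (x, y)); simpl; ring. }
    assert (0 <= Rmax (Rabs (fst w)) (Rabs (snd w)))
      by (eapply Rle_trans; [apply Rabs_pos | apply Rmax_l]).
    assert (e * m <= e * Cmod ((u, v) - (x, y))%C)
      by (apply Rmult_le_compat_l; lra).
    nra.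
Qed.

Lemma differentiable_pt_lim_partials (f : R -> R -> R) (x y lx ly : R) :
  differentiable_pt_lim f x y lx ly ->
  is_derive (fun u => f u y) x lx /\ is_derive (fun v => f x v) y ly.
Proof.
  intros H. split; apply is_derive_Reals.
  - replace lx with (lx * 1 + ly * 0) by ring.
    apply (derivable_pt_lim_comp_2d f (fun u => u) (fun _ => y)); [exact H| |].
    + apply derivable_pt_lim_id.
    + apply derivable_pt_lim_const.
  - replace ly with (lx * 0 + ly * 1) by ring.
    apply (derivable_pt_lim_comp_2d f (fun _ => x) (fun v => v)); [exact H| |].
    + apply derivable_pt_lim_const.
    + apply derivable_pt_lim_id.
Qed.

Lemma is_twice_dz_Re (f : C -> C) (z l : C) :
  is_cderive f z l -> is_twice_dz (fun w => Re (f w)) z l.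
Proof.
  intros H. apply is_cderive_differentiable in H. destruct H as [H _].
  apply differentiable_pt_lim_partials in H. exact H.
Qed.

(** * Square neighbourhoods and functions with vanishing derivative *)

Definition square (c : C) (r : R) (z : C) : Prop :=
  Rabs (Re z - Re c) < r /\ Rabs (Im z - Im c) < r.

Lemma square_center (c : C) (r : R) : 0 < r -> square c r c.
Proof. intros Hr; split; rewrite Rminus_diag, Rabs_R0; exact Hr. Qed.

Lemma square_open (c : C) (r : R) (z : C) :
  square c r z -> exists d, 0 < d /\ forall w, square z d w -> square c r w.
Proof.
  intros [H1 H2].
  exists (Rmin (r - Rabs (Re z - Re c)) (r - Rabs (Im z - Im c))).
  split; [apply Rmin_glb_lt; lra|].
  intros w [H3 H4]. split.
  - pose proof (Rmin_l (r - Rabs (Re z - Re c)) (r - Rabs (Im z - Im c))).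
    replace (Re w - Re c) with ((Re w - Re z) + (Re z - Re c)) by ring.
    pose proof (Rabs_triang (Re w - Re z) (Re z - Re c)). lra.
  - pose proof (Rmin_r (r - Rabs (Re z - Re c)) (r - Rabs (Im z - Im c))).
    replace (Im w - Im c) with ((Im w - Im z) + (Im z - Im c)) by ring.
    pose proof (Rabs_triang (Im w - Im z) (Im z - Im c)). lra.
Qed.

Lemma open_square (D : C -> Prop) (c : C) :
  open D -> D c -> exists r, 0 < r /\ forall z, square c r z -> D z.
Proof.
  intros HD Hc. destruct (HD c Hc) as [d Hd].
  exists d. split; [apply cond_pos|]. intros z Hz. apply Hd. exact Hz.
Qed.

Lemma Rabs_between (r a b c t : R) :
  Rabs (a - c) < r -> Rabs (b - c) < r -> Rmin a b <= t <= Rmax a b ->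
  Rabs (t - c) < r.
Proof.
  intros Ha Hb Ht. apply Rabs_def2 in Ha. apply Rabs_def2 in Hb.
  apply Rabs_def1; revert Ht; unfold Rmin, Rmax; destruct (Rle_dec a b); lra.
Qed.

Lemma is_derive_zero_const (f : R -> R) (a b : R) :
  (forall t, Rmin a b <= t <= Rmax a b -> is_derive f t 0) -> f b = f a.
Proof.
  intros H. destruct (MVT_gen f a b (fun _ => 0)) as [c [_ Hc]].
  - intros t Ht. apply H. lra.
  - intros t Ht. apply derivable_continuous_pt.
    exists 0. apply is_derive_Reals, H, Ht.
  - lra.
Qed.

(** Only partial derivatives are given, so the point is joined to the centre by a horizontal and
    then a vertical segment; both stay in the square. *)
Lemma square_const_of_dz_zero (f : C -> R) (c : C) (r : R) (z : C) :
  (forall w, square c r w -> is_twice_dz f w (RtoC 0)) ->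
  square c r z -> f z = f c.
Proof.
  destruct z as [x y], c as [x0 y0]. intros H [H1 H2]; simpl in H1, H2.
  assert (Hr : 0 < r) by (pose proof (Rabs_pos (x - x0)); lra).
  transitivity (f (x0, y)).
  - apply (is_derive_zero_const (fun t => f (t, y))). intros t Ht.
    destruct (H (t, y)) as [K _]; [|exact K].
    split; simpl; [|exact H2]. apply (Rabs_between r x0 x); auto.
    rewrite Rminus_diag, Rabs_R0; exact Hr.
  - apply (is_derive_zero_const (fun t => f (x0, t))). intros t Ht.
    destruct (H (x0, t)) as [_ K]; [|simpl in K; rewrite Ropp_0 in K; exact K].
    split; simpl; [rewrite Rminus_diag, Rabs_R0; exact Hr|].
    apply (Rabs_between r y0 y); auto. rewrite Rminus_diag, Rabs_R0; exact Hr.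
Qed.

Lemma plane_in_square (z : C) : square (RtoC 0) (Cmod z + 1) z.
Proof.
  pose proof (Rmax_Cmod z). pose proof (Rmax_l (Rabs (fst z)) (Rabs (snd z))).
  pose proof (Rmax_r (Rabs (fst z)) (Rabs (snd z))).
  split; unfold Re, Im, RtoC; simpl; rewrite Rminus_0_r; lra.
Qed.

Lemma plane_const_of_dz_zero (f : C -> R) :
  (forall w, is_twice_dz f w (RtoC 0)) -> forall z, f z = f (RtoC 0).
Proof.
  intros H z. apply (square_const_of_dz_zero f _ (Cmod z + 1)).
  - intros w _. apply H.
  - apply plane_in_square.
Qed.

Lemma is_cderive_continuous (f : C -> C) (z l : C) :
  is_cderive f z l ->
  forall r, 0 < r -> exists d, 0 < d /\ forall w, square z d w -> square (f z) r (f w).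
Proof.
  intros H r Hr. apply is_cderive_differentiable in H. destruct H as [H1 H2].
  assert (C1 := differentiable_continuity_pt _ _ _ (ex_intro _ _ (ex_intro _ _ H1))).
  assert (C2 := differentiable_continuity_pt _ _ _ (ex_intro _ _ (ex_intro _ _ H2))).
  destruct (C1 (mkposreal r Hr)) as [d1 Hd1].
  destruct (C2 (mkposreal r Hr)) as [d2 Hd2].
  exists (Rmin d1 d2). split; [apply Rmin_glb_lt; apply cond_pos|].
  destruct z as [x y]. intros [u v] [Hu Hv]; simpl in *.
  pose proof (Rmin_l d1 d2). pose proof (Rmin_r d1 d2).
  split; [apply Hd1 | apply Hd2]; lra.
Qed.

(** * Goursat's theorem *)

Section Subdivision.
Variable J : R -> R -> R -> R.
Let big (h : R) (e : R) (p : R * R) : Prop := e <= Rabs (J (fst p) (snd p) h).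

(** Here [h] is half the side of the current square and [p] its lower left corner. The fourth
    quarter is taken by default, without a test. *)
Let child (h e : R) (p : R * R) : R * R :=
  if Rle_dec e (Rabs (J (fst p) (snd p) h)) then p
  else if Rle_dec e (Rabs (J (fst p + h) (snd p) h)) then (fst p + h, snd p)
  else if Rle_dec e (Rabs (J (fst p) (snd p + h) h)) then (fst p, snd p + h)
  else (fst p + h, snd p + h).

(** In the successor case [n] still denotes [S m], so [/ 2 ^ n] is the side of the new square, not
    of the one being divided. *)
Let corner (e : R) : nat -> R * R :=
  fix corner n := match n with
    | O => (0, 0)
    | S m => child (/ 2 ^ n) (e * (/ 2 ^ n * / 2 ^ n)) (corner m)
    end.

(** Goursat's bisection, for any quantity [J s t h] attached to the square of corner [(s, t)] and
    side [h]. If the total is nonzero, some quarter always carries at least a quarter of the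
    absolute value; the nested squares shrink to a point where [J] decays like the area, which
    contradicts the [o(h^2)] bound. *)
Lemma subdivision_zero :
  (forall s t h, 0 < h -> 0 <= s -> s + 2 * h <= 1 -> 0 <= t -> t + 2 * h <= 1 ->
     J s t (2 * h) = J s t h + J (s + h) t h + J s (t + h) h + J (s + h) (t + h) h) ->
  (forall s0 t0, 0 <= s0 <= 1 -> 0 <= t0 <= 1 -> forall e, 0 < e ->
     exists d, 0 < d /\ forall s t h, 0 < h < d ->
       0 <= s -> s + h <= 1 -> 0 <= t -> t + h <= 1 ->
       s <= s0 <= s + h -> t <= t0 <= t + h -> Rabs (J s t h) <= e * (h * h)) ->
  J 0 0 1 = 0.
Proof.
  intros Hadd Hloc.
  destruct (Req_dec (J 0 0 1) 0) as [|Hne]; [assumption|exfalso].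
  set (e := Rabs (J 0 0 1)).
  assert (He : 0 < e) by (apply Rabs_pos_lt, Hne).
  assert (Hpow : forall n, 0 < / 2 ^ n) by (intro n; apply Rinv_0_lt_compat, pow_lt; lra).
  assert (Hhalf : forall n, / 2 ^ n = 2 * / 2 ^ S n).
  { intro n. simpl. field. apply pow_nonzero; lra. }
  assert (Hchild : forall h q p,
    let c := child h q p in
    fst p <= fst c <= fst p + h /\ snd p <= snd c <= snd p + h \/ h < 0).
  { intros h q [s t]. unfold child; simpl.
    destruct (Rlt_dec h 0); [right; lra|left].
    repeat destruct Rle_dec; simpl; lra. }
  assert (Hinv : forall n, let p := corner e n in
    0 <= fst p /\ fst p + / 2 ^ n <= 1 /\ 0 <= snd p /\ snd p + / 2 ^ n <= 1 /\
    big (/ 2 ^ n) (e * (/ 2 ^ n * / 2 ^ n)) p).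
  { induction n as [|n IH].
    - unfold big; simpl. rewrite Rinv_1. unfold e. lra.
    - cbv zeta in IH. destruct IH as (I1 & I2 & I3 & I4 & I5).
      change (corner e (S n)) with
        (child (/ 2 ^ S n) (e * (/ 2 ^ S n * / 2 ^ S n)) (corner e n)).
      pose proof (Hpow (S n)) as Hp.
      rewrite (Hhalf n) in I2, I4, I5.
      set (h := / 2 ^ S n) in *. set (p := corner e n) in *.
      destruct (Hchild h (e * (h * h)) p) as [[B1 B2]|]; [|lra].
      cbv zeta. split; [lra|]. split; [lra|]. split; [lra|]. split; [lra|].
      unfold big in *. unfold child.
      rewrite (Hadd (fst p) (snd p) h) in I5 by lra.
      destruct Rle_dec; [assumption|].
      destruct Rle_dec; [assumption|].
      destruct Rle_dec; [assumption|]. simpl.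
      (* The default quarter: the whole square carries at least [4 * e * h^2] and the other three
         quarters less than [e * h^2] each. *)
      pose proof (Rabs_triang (J (fst p) (snd p) h + J (fst p + h) (snd p) h
        + J (fst p) (snd p + h) h) (J (fst p + h) (snd p + h) h)).
      pose proof (Rabs_triang (J (fst p) (snd p) h + J (fst p + h) (snd p) h)
        (J (fst p) (snd p + h) h)).
      pose proof (Rabs_triang (J (fst p) (snd p) h) (J (fst p + h) (snd p) h)).
      nra. }
  assert (Hmono : forall n,
    fst (corner e n) <= fst (corner e (S n)) <= fst (corner e n) + / 2 ^ S n /\
    snd (corner e n) <= snd (corner e (S n)) <= snd (corner e n) + / 2 ^ S n).
  { intro n. destruct (Hchild (/ 2 ^ S n) (e * (/ 2 ^ S n * / 2 ^ S n)) (corner e n))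
      as [H|H]; [exact H|]. pose proof (Hpow (S n)); lra. }
  (* The left ends [a n] and the right ends [a n + / 2 ^ n] are adjacent sequences; their common
     limit lies in every interval. *)
  assert (Hlim : forall a : nat -> R,
    (forall n, a n <= a (S n) <= a n + / 2 ^ S n) ->
    exists l, forall n, a n <= l <= a n + / 2 ^ n).
  { intros a Ha.
    assert (Hd : forall n, a (S n) + / 2 ^ S n <= a n + / 2 ^ n).
    { intro n. rewrite (Hhalf n). destruct (Ha n). lra. }
    destruct (ex_lim_seq_adj a (fun n => a n + / 2 ^ n)) as (E1 & E2 & E3).
    - intro n. apply Ha.
    - exact Hd.
    - apply is_lim_seq_ext with (fun n => (/ 2) ^ n).
      + intro n. rewrite pow_inv. ring.
      + apply is_lim_seq_geom. rewrite Rabs_right; lra.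
    - destruct E1 as [l1 L1]. destruct E2 as [l2 L2].
      rewrite (is_lim_seq_unique _ _ L1), (is_lim_seq_unique _ _ L2) in E3.
      injection E3 as <-.
      exists l1. intro n. split.
      + apply (is_lim_seq_incr_compare a l1 L1). intro; apply Ha.
      + apply (is_lim_seq_decr_compare (fun n => a n + / 2 ^ n) l1 L2). exact Hd. }
  destruct (Hlim (fun n => fst (corner e n))) as [s0 Hs]; [intro; apply Hmono|].
  destruct (Hlim (fun n => snd (corner e n))) as [t0 Ht]; [intro; apply Hmono|].
  (* The squares satisfy [e * h^2 <= |J|], so the local bound with [e / 2] is strictly violated. *)
  destruct (Hloc s0 t0) with (e := e / 2) as (d & Hd & Hsmall); [| |lra|].
  - specialize (Hs O); simpl in Hs; rewrite Rinv_1 in Hs; lra.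
  - specialize (Ht O); simpl in Ht; rewrite Rinv_1 in Ht; lra.
  - destruct (pow_lt_1_zero (/ 2)) with (y := d) as [n Hn];
      [rewrite Rabs_right; lra | exact Hd|].
    specialize (Hn n (le_n n)). rewrite pow_inv, Rabs_right in Hn
      by (left; apply Hpow).
    destruct (Hinv n) as (I1 & I2 & I3 & I4 & I5).
    pose proof (Hpow n) as Hp.
    specialize (Hsmall (fst (corner e n)) (snd (corner e n)) (/ 2 ^ n)
      (conj Hp Hn) I1 I2 I3 I4 (Hs n) (Ht n)).
    unfold big in I5.
    assert (0 < e * (/ 2 ^ n * / 2 ^ n)) by (apply Rmult_lt_0_compat; [|apply Rmult_lt_0_compat]; assumption).
    lra.
Qed.
End Subdivision.

Section Goursat.
Variables (u v lux luy lvx lvy : R -> R -> R) (x0 x1 y0 y1 : R).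
Hypothesis Hu : forall x y, Rmin x0 x1 <= x <= Rmax x0 x1 -> Rmin y0 y1 <= y <= Rmax y0 y1 ->
  differentiable_pt_lim u x y (lux x y) (luy x y).
Hypothesis Hv : forall x y, Rmin x0 x1 <= x <= Rmax x0 x1 -> Rmin y0 y1 <= y <= Rmax y0 y1 ->
  differentiable_pt_lim v x y (lvx x y) (lux x y).

(** The rectangle is an affine image of the unit square. It may thus be degenerate or traversed
    backwards, while the pieces remain squares in the parameters. *)
Let X s := x0 + (x1 - x0) * s.
Let Y t := y0 + (y1 - y0) * t.

Lemma affine_between (a b s : R) :
  0 <= s <= 1 -> Rmin a b <= a + (b - a) * s <= Rmax a b.
Proof.
  intros Hs. unfold Rmin, Rmax. destruct (Rle_dec a b); nra.
Qed.

Lemma between_unit_image (a b s t w : R) :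
  0 <= s <= 1 -> 0 <= t <= 1 ->
  Rmin (a + (b - a) * s) (a + (b - a) * t) <= w <= Rmax (a + (b - a) * s) (a + (b - a) * t) ->
  Rmin a b <= w <= Rmax a b.
Proof.
  intros Hs Ht. pose proof (affine_between a b s Hs). pose proof (affine_between a b t Ht).
  unfold Rmin at 1, Rmax at 1. destruct Rle_dec; lra.
Qed.

Let ex_u s t1 t2 : 0 <= s <= 1 -> 0 <= t1 <= 1 -> 0 <= t2 <= 1 ->
  ex_RInt (u (X s)) (Y t1) (Y t2).
Proof.
  intros Hs H1 H2. apply (ex_RInt_continuous (V := R_CompleteNormedModule)).
  intros y Hy. apply (ex_derive_continuous (K := R_AbsRing) (V := R_NormedModule)).
  eexists. refine (proj2 (differentiable_pt_lim_partials _ _ _ _ _ (Hu (X s) y _ _))).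
  - apply affine_between, Hs.
  - apply (between_unit_image y0 y1 t1 t2); assumption.
Qed.

Let ex_v t s1 s2 : 0 <= t <= 1 -> 0 <= s1 <= 1 -> 0 <= s2 <= 1 ->
  ex_RInt (fun x => v x (Y t)) (X s1) (X s2).
Proof.
  intros Hs H1 H2. apply (ex_RInt_continuous (V := R_CompleteNormedModule)).
  intros x Hx. apply (ex_derive_continuous (K := R_AbsRing) (V := R_NormedModule)).
  eexists. refine (proj1 (differentiable_pt_lim_partials _ _ _ _ _ (Hv x (Y t) _ _))).
  - apply (between_unit_image x0 x1 s1 s2); assumption.
  - apply affine_between, Hs.
Qed.

Let U s t1 t2 := RInt (u (X s)) (Y t1) (Y t2).
Let V t s1 s2 := RInt (fun x => v x (Y t)) (X s1) (X s2).
Let J s t h := U (s + h) t (t + h) - U s t (t + h) - V (t + h) s (s + h) + V t s (s + h).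

Let U_chasles s t1 t2 t3 : 0 <= s <= 1 -> 0 <= t1 <= 1 -> 0 <= t2 <= 1 -> 0 <= t3 <= 1 ->
  U s t1 t3 = U s t1 t2 + U s t2 t3.
Proof. intros. symmetry. apply (RInt_Chasles (V := R_CompleteNormedModule)); apply ex_u; assumption. Qed.

Let V_chasles t s1 s2 s3 : 0 <= t <= 1 -> 0 <= s1 <= 1 -> 0 <= s2 <= 1 -> 0 <= s3 <= 1 ->
  V t s1 s3 = V t s1 s2 + V t s2 s3.
Proof. intros. symmetry. apply (RInt_Chasles (V := R_CompleteNormedModule)); apply ex_v; assumption. Qed.

Let side_bound (f g : R -> R) (a b l e : R) :
  ex_RInt f a b -> ex_RInt g a b ->
  (forall t, Rmin a b <= t <= Rmax a b -> Rabs (f t - g t - l) <= e) ->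
  Rabs (RInt f a b - RInt g a b - l * (b - a)) <= Rabs (b - a) * e.
Proof.
  intros Hf Hg He.
  apply (norm_RInt_le_const_abs (V := R_NormedModule) (fun t => f t - g t - l) a b).
  - exact He.
  - replace (l * (b - a)) with (scal (b - a) l) by (unfold scal; simpl; unfold mult; simpl; ring).
    apply (is_RInt_minus (V := R_NormedModule)); [apply (is_RInt_minus (V := R_NormedModule))|].
    + apply (RInt_correct (V := R_CompleteNormedModule)), Hf.
    + apply (RInt_correct (V := R_CompleteNormedModule)), Hg.
    + apply (is_RInt_const (V := R_NormedModule)).
Qed.

Let scale_bound (a b s0 s1 h t M : R) : Rabs (b - a) < M ->
  s0 <= s1 <= s0 + h -> s0 <= t <= s0 + h -> 0 < h ->
  Rabs (a + (b - a) * s1 - (a + (b - a) * t)) <= M * h.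
Proof.
  intros HM H1 H2 Hh.
  replace (a + (b - a) * s1 - (a + (b - a) * t)) with ((b - a) * (s1 - t)) by ring.
  rewrite Rabs_mult. pose proof (Rabs_pos (b - a)).
  assert (Rabs (s1 - t) <= h) by (apply Rabs_le; lra).
  pose proof (Rabs_pos (s1 - t)). nra.
Qed.

(** The left side is the integral of [v dx + u dy] around the rectangle. The form is closed because
    [lux] is both the [x]-derivative of [u] and the [y]-derivative of [v]. No continuity of the
    partial derivatives is assumed, so Green's formula is replaced by subdivision: on a small square
    the linear parts cancel and the rest is [o(h^2)]. *)
Lemma rectangle_integral_zero :
  RInt (u x1) y0 y1 - RInt (u x0) y0 y1
  - RInt (fun x => v x y1) x0 x1 + RInt (fun x => v x y0) x0 x1 = 0.
Proof.
  assert (HJ : J 0 0 1 = 0).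
  { apply subdivision_zero.
    - intros s t h Hh H1 H2 H3 H4. unfold J.
      replace (s + 2 * h) with (s + h + h) by ring.
      replace (t + 2 * h) with (t + h + h) by ring.
      rewrite (U_chasles (s + h + h) t (t + h) (t + h + h)),
        (U_chasles s t (t + h) (t + h + h)), (V_chasles (t + h + h) s (s + h) (s + h + h)),
        (V_chasles t s (s + h) (s + h + h)) by lra. ring.
    - intros s0 t0 Hs0 Ht0 e He.
      (* [M] exceeds both side lengths. Each pair of opposite sides will contribute at most
         [M h * 2 e' M h], in total [4 M^2 e' h^2]; hence the choice of [e']. *)
      set (M := Rabs (x1 - x0) + Rabs (y1 - y0) + 1).
      pose proof (Rabs_pos (x1 - x0)) as PX. pose proof (Rabs_pos (y1 - y0)) as PY.
      assert (HM : 1 <= M) by (unfold M; lra).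
      assert (He' : 0 < e / (4 * (M * M))) by (apply Rdiv_lt_0_compat; nra).
      set (e' := e / (4 * (M * M))) in *.
      assert (Ee : e = 4 * (M * M) * e') by (unfold e'; field; lra).
      destruct (Hu (X s0) (Y t0) (affine_between _ _ _ Hs0) (affine_between _ _ _ Ht0)
        (mkposreal e' He')) as [d1 Hd1].
      destruct (Hv (X s0) (Y t0) (affine_between _ _ _ Hs0) (affine_between _ _ _ Ht0)
        (mkposreal e' He')) as [d2 Hd2].
      pose proof (cond_pos d1) as D1. pose proof (cond_pos d2) as D2.
      exists (Rmin d1 d2 / M). split.
      { apply Rdiv_lt_0_compat; [apply Rmin_glb_lt; assumption | lra]. }
      intros s t h [Hh Hhd] H1 H2 H3 H4 H5 H6.
      assert (HMh : M * h < Rmin d1 d2).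
      { apply (Rmult_lt_compat_l M) in Hhd; [|lra].
        replace (M * (Rmin d1 d2 / M)) with (Rmin d1 d2) in Hhd by (field; lra). lra. }
      pose proof (Rmin_l d1 d2). pose proof (Rmin_r d1 d2).
      set (p := lux (X s0) (Y t0)) in *.
      assert (KX : forall s', s <= s' <= s + h -> Rabs (X s' - X s0) <= M * h)
        by (intros; apply (scale_bound _ _ s); unfold M; lra).
      assert (KY : forall t', t <= t' <= t + h -> Rabs (Y t' - Y t0) <= M * h)
        by (intros; apply (scale_bound _ _ t); unfold M; lra).
      assert (KXb : forall w, Rmin (X s) (X (s + h)) <= w <= Rmax (X s) (X (s + h)) ->
        Rabs (w - X s0) <= M * h).
      { intros w. pose proof (KX s ltac:(lra)) as K1. pose proof (KX (s + h) ltac:(lra)) as K2.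
        apply Rabs_le_between in K1. apply Rabs_le_between in K2. intros K3.
        apply Rabs_le_between. revert K3. unfold Rmin, Rmax; destruct Rle_dec; lra. }
      assert (KYb : forall w, Rmin (Y t) (Y (t + h)) <= w <= Rmax (Y t) (Y (t + h)) ->
        Rabs (w - Y t0) <= M * h).
      { intros w. pose proof (KY t ltac:(lra)) as K1. pose proof (KY (t + h) ltac:(lra)) as K2.
        apply Rabs_le_between in K1. apply Rabs_le_between in K2. intros K3.
        apply Rabs_le_between. revert K3. unfold Rmin, Rmax; destruct Rle_dec; lra. }
      (* On opposite sides the linear terms in [w - Y t0] agree, so the difference keeps only [p]
         times the area. The same area term occurs in [BV] and cancels in [J]. *)
      assert (BU : Rabs (U (s + h) t (t + h) - U s t (t + h)
                     - p * (X (s + h) - X s) * (Y (t + h) - Y t))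
                   <= Rabs (Y (t + h) - Y t) * (2 * (e' * (M * h)))).
      { apply side_bound; [apply ex_u; lra | apply ex_u; lra|].
        intros w Hw. apply KYb in Hw.
        assert (HH : forall s', s <= s' <= s + h ->
          Rabs (u (X s') w - u (X s0) (Y t0)
             - (p * (X s' - X s0) + luy (X s0) (Y t0) * (w - Y t0))) <= e' * (M * h)).
        { intros s' Hs'. pose proof (KX s' Hs'). eapply Rle_trans; [apply Hd1; lra|].
          simpl. apply Rmult_le_compat_l; [lra|]. apply Rmax_lub; assumption. }
        pose proof (HH s ltac:(lra)) as E1. pose proof (HH (s + h) ltac:(lra)) as E2.
        apply Rabs_le_between in E1. apply Rabs_le_between in E2.
        apply Rabs_le_between. lra. }
      assert (BV : Rabs (V (t + h) s (s + h) - V t s (s + h)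
                     - p * (Y (t + h) - Y t) * (X (s + h) - X s))
                   <= Rabs (X (s + h) - X s) * (2 * (e' * (M * h)))).
      { apply (side_bound (fun x => v x (Y (t + h))) (fun x => v x (Y t)));
          [apply ex_v; lra | apply ex_v; lra|].
        intros w Hw. apply KXb in Hw.
        assert (HH : forall t', t <= t' <= t + h ->
          Rabs (v w (Y t') - v (X s0) (Y t0)
             - (lvx (X s0) (Y t0) * (w - X s0) + p * (Y t' - Y t0))) <= e' * (M * h)).
        { intros t' Ht'. pose proof (KY t' Ht'). eapply Rle_trans; [apply Hd2; lra|].
          simpl. apply Rmult_le_compat_l; [lra|]. apply Rmax_lub; assumption. }
        pose proof (HH t ltac:(lra)) as E1. pose proof (HH (t + h) ltac:(lra)) as E2.
        apply Rabs_le_between in E1. apply Rabs_le_between in E2.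
        apply Rabs_le_between. lra. }
      assert (LX : Rabs (X (s + h) - X s) <= M * h) by (apply (scale_bound _ _ s); unfold M; lra).
      assert (LY : Rabs (Y (t + h) - Y t) <= M * h) by (apply (scale_bound _ _ t); unfold M; lra).
      assert (Hq : 0 <= 2 * (e' * (M * h))) by (assert (0 < M * h) by nra; nra).
      apply (Rmult_le_compat_r _ _ _ Hq) in LX. apply (Rmult_le_compat_r _ _ _ Hq) in LY.
      apply Rabs_le_between in BU. apply Rabs_le_between in BV.
      apply Rabs_le_between.
      replace (e * (h * h)) with (2 * (M * h * (2 * (e' * (M * h))))) by (rewrite Ee; ring).
      unfold J. lra. }
  revert HJ. unfold J, U, V, X, Y. rewrite !Rplus_0_l, !Rmult_0_r, !Rmult_1_r, !Rplus_0_r.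
  replace (x0 + (x1 - x0)) with x1 by ring. replace (y0 + (y1 - y0)) with y1 by ring.
  intro HJ; exact HJ.
Qed.
End Goursat.

(** * Local complex primitives *)

Lemma square_locally (c : C) (r : R) (P : C -> Prop) (z : C) :
  square c r z -> (forall w, square c r w -> P w) ->
  locally (T := prod_UniformSpace R_UniformSpace R_UniformSpace) z P.
Proof.
  intros Hz HP. destruct (square_open c r z Hz) as (d & Hd & Hsq).
  exists (mkposreal d Hd). intros w Hw. apply HP, Hsq. exact Hw.
Qed.

(** Total differentiability from partial derivatives: the [x]-derivative is [Re psi], which is
    continuous because [psi] is complex differentiable. *)
Lemma differentiable_of_dz (X : C -> R) (psi : C -> C) (c : C) (r : R) :
  (forall w, square c r w -> is_twice_dz X w (psi w)) ->
  (forall w, square c r w -> exists l, is_cderive psi w l) ->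
  forall w, square c r w ->
    differentiable_pt_lim (fun x y => X (x, y)) (Re w) (Im w) (Re (psi w)) (- Im (psi w)).
Proof.
  intros HX Hpsi [x y] Hw. simpl (Re (x, y)); simpl (Im (x, y)).
  apply filterdiff_differentiable_pt_lim.
  apply (is_derive_filterdiff (fun x y => X (x, y)) x y
           (fun x y => Re (psi (x, y))) (- Im (psi (x, y)))).
  - apply (square_locally c r); [exact Hw|].
    intros [a b] Hab. apply (HX (a, b) Hab).
  - apply (HX (x, y) Hw).
  - destruct (Hpsi _ Hw) as [l Hl]. apply is_cderive_differentiable in Hl.
    destruct Hl as [Hl _]. simpl in Hl.
    apply (proj1 (continuity_2d_pt_filterlim (fun x y => Re (psi (x, y))) x y)).
    apply (differentiable_continuity_pt (fun x y => Re (psi (x, y)))).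
    eexists; eexists; exact Hl.
Qed.

Lemma is_derive_RInt_square (f : R -> R) (c r a x : R) :
  Rabs (a - c) < r -> Rabs (x - c) < r ->
  (forall t, Rabs (t - c) < r -> continuous f t) ->
  is_derive (fun x => RInt f a x) x (f x).
Proof.
  intros Ha Hx Hf.
  apply (is_derive_RInt (V := R_NormedModule) f (fun x => RInt f a x) a x).
  - assert (Hd : 0 < r - Rabs (x - c)) by lra.
    exists (mkposreal _ Hd). intros b Hb.
    change (Rabs (b - x) < r - Rabs (x - c)) in Hb.
    apply (RInt_correct (V := R_CompleteNormedModule)).
    apply (ex_RInt_continuous (V := R_CompleteNormedModule)).
    intros t Ht. apply Hf. apply (Rabs_between r a b); auto.
    replace (b - c) with ((b - x) + (x - c)) by ring.
    pose proof (Rabs_triang (b - x) (x - c)). lra.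
  - apply Hf, Hx.
Qed.

(** [F = X + i V] with [V] a harmonic conjugate of [X], obtained by integrating [v dx + u dy] from
    the centre, where [psi = u + i v]. *)
Lemma local_primitive (X : C -> R) (psi : C -> C) (c : C) (r : R) :
  (forall w, square c r w -> is_twice_dz X w (psi w)) ->
  (forall w, square c r w -> exists l, is_cderive psi w l) ->
  exists F : C -> C, forall w, square c r w -> Re (F w) = X w /\ is_cderive F w (psi w).
Proof.
  intros HX Hpsi. destruct c as [x0 y0].
  set (u := fun x y => Re (psi (x, y))). set (v := fun x y => Im (psi (x, y))).
  set (l := fun x y => C_derive psi (x, y)).
  assert (Hl : forall x y, square (x0, y0) r (x, y) ->
    differentiable_pt_lim u x y (Re (l x y)) (- Im (l x y)) /\
    differentiable_pt_lim v x y (Im (l x y)) (Re (l x y))).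
  { intros x y Hw. destruct (Hpsi _ Hw) as [k Hk].
    unfold l. rewrite (is_C_derive_unique psi (x, y) k Hk).
    apply is_cderive_differentiable in Hk. exact Hk. }
  assert (Hc : forall x y, square (x0, y0) r (x, y) ->
    continuous (u x) y /\ continuous (fun t => v t y) x).
  { intros x y Hw. destruct (Hl x y Hw) as [H1 H2].
    apply differentiable_pt_lim_partials in H1. apply differentiable_pt_lim_partials in H2.
    split; apply (ex_derive_continuous (K := R_AbsRing) (V := R_NormedModule)); eexists;
      [apply H1 | apply H2]. }
  set (V := fun x y => RInt (fun t => v t y0) x0 x + RInt (u x) y0 y).
  (* The other path around the rectangle gives the same value. The final segment of each path makes
     one partial derivative of [V] evident. *)
  assert (HV : forall x y, square (x0, y0) r (x, y) ->
    V x y = RInt (u x0) y0 y + RInt (fun t => v t y) x0 x).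
  { intros x y [Hx Hy]; simpl in Hx, Hy.
    pose proof (Rabs_pos (x - x0)) as P.
    assert (Z : forall a, Rabs (a - a) < r) by (intro; rewrite Rminus_diag, Rabs_R0; lra).
    pose proof (rectangle_integral_zero u v (fun x y => Re (l x y)) (fun x y => - Im (l x y))
      (fun x y => Im (l x y)) x0 x y0 y) as G.
    unfold V. enough (RInt (u x) y0 y - RInt (u x0) y0 y - RInt (fun t => v t y) x0 x
      + RInt (fun t => v t y0) x0 x = 0) by lra.
    apply G; intros a b Ha Hb; apply Hl; split; simpl;
      [apply (Rabs_between r x0 x)|apply (Rabs_between r y0 y)|apply (Rabs_between r x0 x)|apply (Rabs_between r y0 y)]; auto. }
  exists (fun w => (X w, V (Re w) (Im w))). intros w Hw. split; [reflexivity|].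
  apply is_cderive_differentiable. split.
  - exact (differentiable_of_dz X psi _ r HX Hpsi w Hw).
  - simpl.
    (* [V] is the real part of [- i F], so [- i psi] is its isotropic component and
       [differentiable_of_dz] applies to [V] as it did to [X]. *)
    set (chi := fun w => (- Ci * psi w)%C).
    assert (D : differentiable_pt_lim V (Re w) (Im w) (Re (chi w)) (- Im (chi w))).
    { apply (differentiable_of_dz (fun z => V (Re z) (Im z)) chi (x0, y0) r); [| |exact Hw].
      - intros [x y] Hz. destruct (Hz) as [Hx Hy]; simpl in Hx, Hy.
        assert (Z : forall a, Rabs (a - a) < r)
          by (intro; rewrite Rminus_diag, Rabs_R0; pose proof (Rabs_pos (x - x0)); lra).

        assert (E1 : Re (chi (x, y)) = plus zero (v x y))
          by (unfold chi, v; change (Re (- Ci * psi (x, y))%C = 0 + Im (psi (x, y)));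
              simpl; unfold Re, Im; ring).
        assert (E2 : - Im (chi (x, y)) = plus zero (u x y))
          by (unfold chi, u; change (- Im (- Ci * psi (x, y))%C = 0 + Re (psi (x, y)));
              simpl; unfold Re, Im; ring).
        unfold is_twice_dz. rewrite E1, E2. simpl (Re (x, y)); simpl (Im (x, y)). split.
        + apply (is_derive_ext_loc (fun t => RInt (u x0) y0 y + RInt (fun t => v t y) x0 t)).
          * assert (Hd : 0 < r - Rabs (x - x0)) by lra.
            exists (mkposreal _ Hd). intros b Hb.
            change (Rabs (b - x) < r - Rabs (x - x0)) in Hb.
            symmetry. apply HV. split; [simpl|exact Hy].
            replace (b - x0) with ((b - x) + (x - x0)) by ring.
            pose proof (Rabs_triang (b - x) (x - x0)). lra.
          * apply (is_derive_plus (K := R_AbsRing) (V := R_NormedModule)).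
            -- apply (is_derive_const (K := R_AbsRing) (V := R_NormedModule)).
            -- apply (is_derive_RInt_square (fun t => v t y) x0 r); auto.
               intros t Ht. exact (proj2 (Hc t y (conj Ht Hy))).
        + apply (is_derive_plus (K := R_AbsRing) (V := R_NormedModule)
            (fun _ => RInt (fun t => v t y0) x0 x) (fun t => RInt (u x) y0 t)).
          * apply (is_derive_const (K := R_AbsRing) (V := R_NormedModule)).
          * apply (is_derive_RInt_square (u x) y0 r); auto.
            intros t Ht. exact (proj1 (Hc x t (conj Hx Ht))).
      - intros z Hz. destruct (Hpsi z Hz) as [k Hk]. eexists.
        apply is_cderive_mult; [apply (is_derive_const (K := C_AbsRing) (V := C_NormedModule))|exact Hk]. }
    replace (Im (psi w)) with (Re (chi w)) by (unfold chi; simpl; unfold Re, Im; ring).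
    replace (Re (psi w)) with (- Im (chi w)) by (unfold chi; simpl; unfold Re, Im; ring).
    exact D.
Qed.

(** * Covariance under real translations *)

Lemma is_cderive_eq (f : C -> C) (z l l' : C) :
  is_cderive f z l -> l = l' -> is_cderive f z l'.
Proof. intros H <-. exact H. Qed.

Lemma is_cderive_const (c z : C) : is_cderive (fun _ => c) z (RtoC 0).
Proof. apply (is_derive_const (K := C_AbsRing) (V := C_NormedModule)). Qed.

Lemma is_cderive_id (z : C) : is_cderive (fun w => w) z (RtoC 1).
Proof.
  apply is_cderive_absring. apply (is_derive_id (K := C_AbsRing)).
Qed.

Lemma is_cderive_plus (f g : C -> C) (z df dg : C) :
  is_cderive f z df -> is_cderive g z dg ->
  is_cderive (fun w => f w + g w)%C z (df + dg)%C.
Proof. apply (is_derive_plus (K := C_AbsRing) (V := C_NormedModule)). Qed.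

Lemma is_cderive_minus (f g : C -> C) (z df dg : C) :
  is_cderive f z df -> is_cderive g z dg ->
  is_cderive (fun w => f w - g w)%C z (df - dg)%C.
Proof. apply (is_derive_minus (K := C_AbsRing) (V := C_NormedModule)). Qed.

Lemma is_cderive_opp (f : C -> C) (z df : C) :
  is_cderive f z df -> is_cderive (fun w => - f w)%C z (- df)%C.
Proof. apply (is_derive_opp (K := C_AbsRing) (V := C_NormedModule)). Qed.

Lemma is_cderive_scal (c : C) (f : C -> C) (z df : C) :
  is_cderive f z df -> is_cderive (fun w => c * f w)%C z (c * df)%C.
Proof.
  intros H. eapply is_cderive_eq.
  - apply is_cderive_mult; [apply is_cderive_const | exact H].
  - cbv beta; ring.
Qed.

Lemma is_cderive_lin3 (c1 c2 c3 : C) (f1 f2 f3 : C -> C) (z d1 d2 d3 : C) :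
  is_cderive f1 z d1 -> is_cderive f2 z d2 -> is_cderive f3 z d3 ->
  is_cderive (fun w => c1 * f1 w + c2 * f2 w + c3 * f3 w)%C z (c1 * d1 + c2 * d2 + c3 * d3)%C.
Proof.
  intros H1 H2 H3.
  apply (is_cderive_plus (fun w => c1 * f1 w + c2 * f2 w)%C (fun w => c3 * f3 w)%C).
  - apply (is_cderive_plus (fun w => c1 * f1 w)%C (fun w => c2 * f2 w)%C);
      apply is_cderive_scal; assumption.
  - apply is_cderive_scal, H3.
Qed.

Lemma is_cderive_ext_square (f g : C -> C) (c : C) (r : R) (z l : C) :
  square c r z -> (forall w, square c r w -> f w = g w) ->
  is_cderive f z l -> is_cderive g z l.
Proof.
  intros Hz Hfg. apply (is_derive_ext_loc (K := C_AbsRing) (V := C_NormedModule)).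
  apply (proj1 (locally_C z (fun w => f w = g w))).
  apply (square_locally c r); assumption.
Qed.

Lemma square_const_of_cderive_zero (f : C -> C) (c : C) (r : R) (z : C) :
  (forall w, square c r w -> is_cderive f w (RtoC 0)) -> square c r z -> f z = f c.
Proof.
  intros H Hz.
  assert (H1 : Re (f z) = Re (f c)).
  { apply (square_const_of_dz_zero (fun w => Re (f w)) c r); [|exact Hz].
    intros w Hw. apply is_twice_dz_Re, H, Hw. }
  assert (H2 : Re (Ci * f z)%C = Re (Ci * f c)%C).
  { apply (square_const_of_dz_zero (fun w => Re (Ci * f w)%C) c r); [|exact Hz].
    intros w Hw. apply (is_twice_dz_Re (fun w => Ci * f w)%C).
    eapply is_cderive_eq; [apply is_cderive_scal, H, Hw | ring]. }
  revert H1 H2. destruct (f z), (f c); simpl; intros H1 H2.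
  apply injective_projections; simpl; lra.
Qed.

Lemma plane_const_of_cderive_zero (f : C -> C) :
  (forall w, is_cderive f w (RtoC 0)) -> forall z, f z = f (RtoC 0).
Proof.
  intros H z. apply (square_const_of_cderive_zero f _ (Cmod z + 1)).
  - intros w _. apply H.
  - apply plane_in_square.
Qed.

Lemma is_cderive_shift (f : C -> C) (c z l : C) :
  is_cderive f (z + c)%C l -> is_cderive (fun w => f (w + c)%C) z l.
Proof.
  intros H. eapply is_cderive_eq.
  - apply (is_cderive_comp f (fun w => w + c)%C); [exact H|].
    apply is_cderive_plus; [apply is_cderive_id | apply is_cderive_const].
  - cbv beta; ring.
Qed.

Lemma is_derive_translate_Re (f : C -> C) (z l : C) :
  is_cderive f z l -> is_derive (fun t : R => Re (f (z + RtoC t)%C)) 0 (Re l).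
Proof.
  intros H.
  assert (H' : is_cderive (fun w => f (w + z)%C) (RtoC 0) l).
  { apply is_cderive_shift. rewrite Cplus_0_l. exact H. }
  apply is_twice_dz_Re in H'. destruct H' as [H' _].
  apply (is_derive_ext (fun x => Re (f ((x, Im (RtoC 0)) + z)%C)) _ 0 (Re l)); [|exact H'].
  intros t. f_equal. f_equal. apply Cplus_comm.
Qed.

Definition has_local_primitives (f : C -> C) : Prop :=
  forall z0, exists (r : R) (F : C -> C),
    0 < r /\ forall z, square z0 r z -> is_cderive F z (f z).

Lemma square_shrink (c : C) (r r' : R) (z : C) : r <= r' -> square c r z -> square c r' z.
Proof. intros Hr [H1 H2]; split; lra. Qed.

Section Covariance.
Variables (f0 f1 f2 f3 : C -> C) (a1 a2 a3 : R -> R) (l1 l2 l3 : R).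
Hypothesis P0 : has_local_primitives f0.
Hypothesis P1 : has_local_primitives f1.
Hypothesis P2 : has_local_primitives f2.
Hypothesis P3 : has_local_primitives f3.
Hypothesis A1 : is_derive a1 0 l1.
Hypothesis A2 : is_derive a2 0 l2.
Hypothesis A3 : is_derive a3 0 l3.
Hypothesis Hcov : forall (z : C) (t : R),
  f0 (z + RtoC t)%C = (RtoC (a1 t) * f1 z + RtoC (a2 t) * f2 z + RtoC (a3 t) * f3 z)%C.

(* Primitives of the [f_i] inherit the covariance up to an additive constant
   depending on [t] only; differentiating at [t = 0] expresses [f0] through these
   primitives, hence [f0] is differentiable although only its primitive was known
   to be. *)
Lemma covariant_is_cderive (z : C) :
  is_cderive f0 z (RtoC l1 * f1 z + RtoC l2 * f2 z + RtoC l3 * f3 z)%C.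
Proof.
  destruct (P0 z) as (r0 & F0 & R0 & D0). destruct (P1 z) as (r1 & F1 & R1 & D1).
  destruct (P2 z) as (r2 & F2 & R2 & D2). destruct (P3 z) as (r3 & F3 & R3 & D3).
  assert (exists r, 0 < r /\ r <= r0 /\ r <= r1 /\ r <= r2 /\ r <= r3) as (r & Hr & L0 & L1 & L2 & L3).
  { exists (Rmin (Rmin r0 r1) (Rmin r2 r3)).
    pose proof (Rmin_l r0 r1). pose proof (Rmin_r r0 r1). pose proof (Rmin_l r2 r3).
    pose proof (Rmin_r r2 r3). pose proof (Rmin_l (Rmin r0 r1) (Rmin r2 r3)).
    pose proof (Rmin_r (Rmin r0 r1) (Rmin r2 r3)).
    repeat split; try lra. repeat apply Rmin_glb_lt; assumption. }
  (* Half of the radius is reserved for the point and half for the translation. *)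
  assert (Hshift : forall w t, square z (r / 2) w -> Rabs t < r / 2 ->
    square z r0 (w + RtoC t)%C).
  { intros [x y] t [Hx Hy] Ht; split; simpl in *.
    - replace (x + t - Re z) with ((x - Re z) + t) by ring.
      pose proof (Rabs_triang (x - Re z) t). lra.
    - rewrite Rplus_0_r. lra. }
  (* Taking differences with the value at [z] removes the additive constant, whose dependence on [t]
     is unknown. *)
  assert (Hdiff : forall w t, square z (r / 2) w -> Rabs t < r / 2 ->
    (F0 (w + RtoC t) - F0 (z + RtoC t))%C =
    (RtoC (a1 t) * (F1 w - F1 z) + RtoC (a2 t) * (F2 w - F2 z)
     + RtoC (a3 t) * (F3 w - F3 z))%C).
  { intros w t Hw Ht.
    set (E := fun v => (F0 (v + RtoC t)
      - (RtoC (a1 t) * F1 v + RtoC (a2 t) * F2 v + RtoC (a3 t) * F3 v))%C).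
    assert (HE : E w = E z).
    { apply (square_const_of_cderive_zero E z (r / 2)); [|exact Hw].
      intros v Hv. eapply is_cderive_eq.
      - apply is_cderive_minus; [apply is_cderive_shift, D0, Hshift; assumption|].
        apply is_cderive_lin3; [apply D1 | apply D2 | apply D3]; (eapply square_shrink; [|exact Hv]; lra).
      - cbv beta; rewrite Hcov; ring. }
    unfold E in HE. rewrite <- (Cplus_0_r (F0 (w + RtoC t)%C)).
    replace (F0 (w + RtoC t)%C) with
      ((F0 (z + RtoC t) - (RtoC (a1 t) * F1 z + RtoC (a2 t) * F2 z + RtoC (a3 t) * F3 z))
       + (RtoC (a1 t) * F1 w + RtoC (a2 t) * F2 w + RtoC (a3 t) * F3 w))%C
      by (rewrite <- HE; ring). ring. }
  (* The derivative in the real variable [t] is taken on real parts only; the multipliers [1] and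
     [i] for [k] then recover the complex identity. *)
  assert (Hre : forall (k : C) w, square z (r / 2) w ->
    Re (k * (f0 w - f0 z))%C = Re (k * (RtoC l1 * (F1 w - F1 z) + RtoC l2 * (F2 w - F2 z)
     + RtoC l3 * (F3 w - F3 z)))%C).
  { intros k w Hw.
    assert (Sq : forall v, square z (r / 2) v -> square z r0 v)
      by (intros v Hv; eapply square_shrink; [|exact Hv]; lra).
    assert (Hz : square z (r / 2) z) by (apply square_center; lra).
    pose proof (is_derive_translate_Re _ w _ (is_cderive_scal k _ _ _ (D0 w (Sq w Hw)))) as T1.
    pose proof (is_derive_translate_Re _ z _ (is_cderive_scal k _ _ _ (D0 z (Sq z Hz)))) as T2.
    pose proof (is_derive_minus (K := R_AbsRing) (V := R_NormedModule) _ _ _ _ _ T1 T2) as T.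
    transitivity (minus (Re (k * f0 w)%C) (Re (k * f0 z)%C)).
    { unfold minus, plus, opp; simpl. ring. }
    etransitivity; [symmetry; exact (is_derive_unique _ _ _ T)|]. apply is_derive_unique.
    set (b1 := Re (k * (F1 w - F1 z))%C). set (b2 := Re (k * (F2 w - F2 z))%C).
    set (b3 := Re (k * (F3 w - F3 z))%C).
    apply (is_derive_ext_loc (fun t => b1 * a1 t + b2 * a2 t + b3 * a3 t)).
    - exists (mkposreal (r / 2) ltac:(lra)). intros t Ht.
      change (Rabs (t - 0) < r / 2) in Ht. rewrite Rminus_0_r in Ht.
      transitivity (Re (k * (F0 (w + RtoC t) - F0 (z + RtoC t)))%C).
      + rewrite Hdiff by assumption. unfold b1, b2, b3. simpl. ring.
      + unfold minus, plus, opp; simpl. ring.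
    - match goal with |- is_derive _ _ ?l =>
        replace l with (b1 * l1 + b2 * l2 + b3 * l3) by (unfold b1, b2, b3; simpl; ring) end.
      apply (is_derive_plus (K := R_AbsRing) (V := R_NormedModule)
        (fun t => b1 * a1 t + b2 * a2 t) (fun t => b3 * a3 t));
        [apply (is_derive_plus (K := R_AbsRing) (V := R_NormedModule)
          (fun t => b1 * a1 t) (fun t => b2 * a2 t))|];
        apply is_derive_scal; assumption. }
  apply (is_cderive_ext_square (fun w => f0 z + (RtoC l1 * (F1 w - F1 z)
     + RtoC l2 * (F2 w - F2 z) + RtoC l3 * (F3 w - F3 z)))%C _ z (r / 2)).
  - apply square_center; lra.
  - intros w Hw. pose proof (Hre (RtoC 1) w Hw) as H1. pose proof (Hre Ci w Hw) as H2.
    match goal with |- (_ + ?e)%C = _ => set (S := e) in * end.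
    revert H1 H2. destruct (f0 w), (f0 z), S; simpl. intros.
    apply injective_projections; simpl; lra.
  - eapply is_cderive_eq.
    + apply is_cderive_plus; [apply is_cderive_const|].
      apply (is_cderive_lin3 _ _ _ (fun w => F1 w - F1 z)%C (fun w => F2 w - F2 z)%C
        (fun w => F3 w - F3 z)%C);
        (apply is_cderive_minus; [|apply is_cderive_const]);
        [apply D1 | apply D2 | apply D3]; apply square_center; lra.
    + cbv beta; ring.
Qed.
End Covariance.

(** * Pull-back to the plane *)

Lemma is_twice_dz_ext_square (f g : C -> R) (c : C) (r : R) (z l : C) :
  square c r z -> (forall w, square c r w -> f w = g w) ->
  is_twice_dz f z l -> is_twice_dz g z l.
Proof.
  intros Hz Hfg. destruct (square_open c r z Hz) as (d & Hd & Hsq).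
  assert (Z : forall a, Rabs (a - a) < d) by (intro; rewrite Rminus_diag, Rabs_R0; lra).
  intros [H1 H2]. split.
  - apply (is_derive_ext_loc (fun x => f (x, Im z))); [|exact H1].
    exists (mkposreal d Hd). intros x Hx. apply Hfg, Hsq. split; [exact Hx | apply Z].
  - apply (is_derive_ext_loc (fun y => f (Re z, y))); [|exact H2].
    exists (mkposreal d Hd). intros y Hy. apply Hfg, Hsq. split; [apply Z | exact Hy].
Qed.

Lemma is_twice_dz_unique (f : C -> R) (z l l' : C) :
  is_twice_dz f z l -> is_twice_dz f z l' -> l = l'.
Proof.
  intros [H1 H2] [H3 H4].
  apply is_derive_unique in H1. apply is_derive_unique in H2.
  apply is_derive_unique in H3. apply is_derive_unique in H4.
  destruct l, l'; simpl in *. f_equal; lra.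
Qed.

Lemma is_twice_dz_plus (f g : C -> R) (z l l' : C) :
  is_twice_dz f z l -> is_twice_dz g z l' ->
  is_twice_dz (fun w => f w + g w) z (l + l')%C.
Proof.
  intros [H1 H2] [H3 H4]. split.
  - apply (is_derive_plus (K := R_AbsRing) (V := R_NormedModule)
      (fun x => f (x, Im z)) (fun x => g (x, Im z))); assumption.
  - replace (- Im (l + l')%C) with (- Im l + - Im l') by (simpl; unfold Im; ring).
    apply (is_derive_plus (K := R_AbsRing) (V := R_NormedModule)
      (fun y => f (Re z, y)) (fun y => g (Re z, y))); assumption.
Qed.

Lemma is_twice_dz_scal (a : R) (f : C -> R) (z l : C) :
  is_twice_dz f z l -> is_twice_dz (fun w => a * f w) z (RtoC a * l)%C.
Proof.
  intros [H1 H2]. split.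
  - rewrite re_scal_l. apply is_derive_scal, H1.
  - replace (- Im (RtoC a * l)%C) with (a * - Im l) by (simpl; unfold Im; ring).
    apply is_derive_scal, H2.
Qed.

Lemma is_twice_dz_const (a : R) (z : C) : is_twice_dz (fun _ => a) z (RtoC 0).
Proof.
  split; simpl; [|rewrite Ropp_0];
    apply (is_derive_const (K := R_AbsRing) (V := R_NormedModule)).
Qed.

Lemma is_twice_dz_translate (f : C -> R) (t : R) (z l : C) :
  is_twice_dz f (z + RtoC t)%C l -> is_twice_dz (fun w => f (w + RtoC t)%C) z l.
Proof.
  destruct z as [x y]. intros [H1 H2]. simpl in H1, H2. rewrite Rplus_0_r in H1, H2.
  split; simpl.
  - rewrite <- (Rmult_1_l (Re l)).
    apply (is_derive_comp (K := R_AbsRing) (V := R_NormedModule) (fun u => f (u, y + 0)) (fun u => u + t)).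
    + rewrite Rplus_0_r. exact H1.
    + auto_derive; [exact I | ring].
  - apply (is_derive_ext (fun v => f (x + t, v))); [|exact H2].
    intro v. f_equal. apply injective_projections; [reflexivity | symmetry; apply Rplus_0_r].
Qed.

Lemma dz_covariance (f0 f1 f2 f3 : C -> R) (p0 p1 p2 p3 : C -> C) (k a1 a2 a3 t : R) :
  (forall z, is_twice_dz f0 z (p0 z)) -> (forall z, is_twice_dz f1 z (p1 z)) ->
  (forall z, is_twice_dz f2 z (p2 z)) -> (forall z, is_twice_dz f3 z (p3 z)) ->
  (forall z, f0 (z + RtoC t)%C = k + a1 * f1 z + a2 * f2 z + a3 * f3 z) ->
  forall z, p0 (z + RtoC t)%C = (RtoC a1 * p1 z + RtoC a2 * p2 z + RtoC a3 * p3 z)%C.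
Proof.
  intros H0 H1 H2 H3 Hc z.
  apply (is_twice_dz_unique (fun w => f0 (w + RtoC t)%C) z).
  - apply is_twice_dz_translate, H0.
  - apply (is_twice_dz_ext_square (fun w => k + a1 * f1 w + a2 * f2 w + a3 * f3 w) _ z 1).
    + apply square_center; lra.
    + intros w _. symmetry. apply Hc.
    + replace (RtoC a1 * p1 z)%C with (RtoC 0 + RtoC a1 * p1 z)%C by ring.
      apply (is_twice_dz_plus (fun w => k + a1 * f1 w + a2 * f2 w)); [|apply is_twice_dz_scal, H3].
      apply (is_twice_dz_plus (fun w => k + a1 * f1 w)); [|apply is_twice_dz_scal, H2].
      apply (is_twice_dz_plus (fun w => k)); [apply is_twice_dz_const | apply is_twice_dz_scal, H1].
Qed.

(** [Re p] is the derivative along the real direction. Applied to the coordinate fixed by the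
    rotations, this makes the constant component purely imaginary. *)
Lemma dz_invariant_Re (f : C -> R) (p : C -> C) :
  (forall z, is_twice_dz f z (p z)) ->
  (forall z t, f (z + RtoC t)%C = f z) -> forall z, Re (p z) = 0.
Proof.
  intros H Hinv z. destruct (H z) as [H1 _].
  apply is_derive_unique in H1. rewrite <- H1. apply is_derive_unique.
  apply (is_derive_ext (fun _ => f (0, Im z))).
  - intro t. rewrite <- (Hinv (0, Im z) t). f_equal.
    apply injective_projections; simpl; ring.
  - apply (is_derive_const (K := R_AbsRing) (V := R_NormedModule)).
Qed.

(* Primitives are required in place of holomorphy of [p] because they pull back along
   a map [h] by composition, without knowing that [h'] is differentiable. *)
Definition harmonic_with (f : C -> R) (p : C -> C) : Prop :=
  (forall z, is_twice_dz f z (p z)) /\ has_local_primitives p.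

(** The infinitesimal form of the invariance, one row of the rotation matrix at a time. The
    translation part [k t] disappears on differentiating in [z], before [t] is varied. *)
Lemma harmonic_covariance (f0 f1 f2 f3 : C -> R) (p0 p1 p2 p3 : C -> C)
    (k a1 a2 a3 : R -> R) (l1 l2 l3 : R) :
  harmonic_with f0 p0 -> harmonic_with f1 p1 -> harmonic_with f2 p2 -> harmonic_with f3 p3 ->
  is_derive a1 0 l1 -> is_derive a2 0 l2 -> is_derive a3 0 l3 ->
  (forall z t, f0 (z + RtoC t)%C = k t + a1 t * f1 z + a2 t * f2 z + a3 t * f3 z) ->
  forall z, is_cderive p0 z (RtoC l1 * p1 z + RtoC l2 * p2 z + RtoC l3 * p3 z)%C.
Proof.
  intros [H0 P0] [H1 P1] [H2 P2] [H3 P3] A1 A2 A3 Hc z.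
  apply covariant_is_cderive with (a1 := a1) (a2 := a2) (a3 := a3); try assumption.
  intros w t. apply (dz_covariance f0 f1 f2 f3 p0 p1 p2 p3 (k t)); auto.
Qed.

Lemma holomorphic_is_cderive (D : C -> Prop) (f : C -> C) (z : C) :
  holomorphic_on D f -> D z -> is_cderive f z (C_derive f z).
Proof.
  intros H Hz. destruct (H z Hz) as [l Hl].
  rewrite (is_C_derive_unique f z l Hl). exact Hl.
Qed.

Lemma is_cderive_conj (f : C -> C) (z l : C) :
  is_cderive f (Cconj z) l -> is_cderive (fun w => Cconj (f (Cconj w))) z (Cconj l).
Proof.
  rewrite !is_cderive_eps. intros H eps. destruct (H eps) as [d Hd].
  exists d. intros w H1 H2.
  assert (E : forall a b : C, (Cconj a - Cconj b)%C = Cconj (a - b)%C)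
    by (intros [a a'] [b b']; apply injective_projections; simpl; ring).
  assert (E' : forall a b : C, Cconj (a * b)%C = (Cconj a * Cconj b)%C)
    by (intros [a a'] [b b']; apply injective_projections; simpl; ring).
  specialize (Hd (Cconj w)).
  rewrite E, <- (Cconj_conj (w - z)%C), <- E', E, !Cmod_conj, <- E.
  rewrite <- (Cmod_conj (w - z)%C), <- E.
  apply Hd; [exact H1|].
  change (Rabs (- Im w - - Im z) < d). replace (- Im w - - Im z) with (- (Im w - Im z)) by ring.
  rewrite Rabs_Ropp. exact H2.
Qed.

(** An antiholomorphic parameter is precomposed with conjugation. Conjugation commutes with real
    translations, so the rotations still act in the same way. *)
Lemma rotational_holomorphic (a : axis) (M : surface) :
  rotational a M ->
  exists (h k : C -> C) (p : R3),
    (forall z, dom M (h z) /\ k (h z) = z) /\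
    (forall w, dom M w -> h (k w) = w) /\
    holomorphic_on plane h /\ holomorphic_on (dom M) k /\
    forall (z : C) (th : R),
      pos M (h (z + RtoC th)%C)
      = add3 p (lorentz_rotation a th (sub3 (pos M (h z)) p)).
Proof.
  intros (h & p & (k & Hh & Hk & Hhol) & Hrot).
  destruct Hhol as [[Hh1 Hk1] | [Hh1 Hk1]].
  - exists h, k, p. repeat split; auto; try (apply Hh; exact I). apply Hk.
  - exists (fun z => h (Cconj z)), (fun w => Cconj (k w)), p.
    repeat split.
    + apply Hh. exact I.
    + destruct (Hh (Cconj z) I) as [_ E]. rewrite E. apply Cconj_conj.
    + intros w Hw. rewrite Cconj_conj. apply Hk, Hw.
    + intros z _. destruct (Hh1 (Cconj z) I) as [l Hl].
      exists (Cconj l). apply is_cderive_conj in Hl.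
      apply (is_derive_ext (K := C_AbsRing) (V := C_NormedModule)
        (fun w => Cconj (Cconj (h (Cconj w))))); [|exact Hl].
      intro w. apply Cconj_conj.
    + exact Hk1.
    + intros z th. rewrite <- Hrot. do 2 f_equal.
      apply injective_projections; simpl; ring.
Qed.

Section Pullback.
Variables (D : C -> Prop) (h : C -> C).
Hypothesis Dopen : open D.
Hypothesis hD : forall z, D (h z).
Hypothesis hhol : holomorphic_on plane h.

(** If [F] is a primitive of [p] with real part [f], then [F] after [h] serves for the pulled-back
    pair by the chain rule, and both parts of [harmonic_with] are read off it. *)
Lemma harmonic_pullback (f : C -> R) (p : C -> C) :
  (forall w, D w -> is_twice_dz f w (p w)) -> holomorphic_on D p ->
  harmonic_with (fun z => f (h z)) (fun z => C_derive h z * p (h z))%C.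
Proof.
  intros Hf Hp.
  assert (Key : forall z0, exists r F, 0 < r /\ forall z, square z0 r z ->
    Re (F z) = f (h z) /\ is_cderive F z (C_derive h z * p (h z))%C).
  { intro z0. destruct (open_square D (h z0) Dopen (hD z0)) as (r & Hr & Hsq).
    destruct (local_primitive f p (h z0) r) as [F HF].
    - intros w Hw. apply Hf, Hsq, Hw.
    - intros w Hw. apply Hp, Hsq, Hw.
    - destruct (is_cderive_continuous h z0 _ (holomorphic_is_cderive _ _ z0 hhol I) r Hr)
        as (d & Hd & Hdsq).
      exists d, (fun z => F (h z)). split; [exact Hd|]. intros z Hz.
      destruct (HF (h z) (Hdsq z Hz)) as [E1 E2]. split; [exact E1|].
      apply is_cderive_comp; [exact E2 | exact (holomorphic_is_cderive _ _ z hhol I)]. }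
  split.
  - intro z. destruct (Key z) as (r & F & Hr & HF).
    apply (is_twice_dz_ext_square (fun w => Re (F w)) _ z r).
    + apply square_center, Hr.
    + intros w Hw. apply HF, Hw.
    + apply is_twice_dz_Re, HF, square_center, Hr.
  - intro z. destruct (Key z) as (r & F & Hr & HF).
    exists r, F. split; [exact Hr|]. intros w Hw. apply HF, Hw.
Qed.

Lemma inverse_derivative (k : C -> C) (w : C) :
  (forall v, D v -> h (k v) = v) -> holomorphic_on D k -> D w ->
  (C_derive k w * C_derive h (k w))%C = RtoC 1.
Proof.
  intros Hk khol Hw.
  pose proof (is_cderive_comp h k w _ _ (holomorphic_is_cderive _ _ (k w) hhol I)
    (holomorphic_is_cderive _ _ w khol Hw)) as H.
  destruct (open_square D w Dopen Hw) as (r & Hr & Hsq).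
  apply (is_cderive_ext_square _ (fun v => v) w r) in H;
    [|apply square_center, Hr | intros v Hv; apply Hk, Hsq, Hv].
  rewrite <- (is_C_derive_unique _ _ _ H).
  apply is_C_derive_unique, is_cderive_id.
Qed.
End Pullback.

(** * The linear differential equations *)

Lemma is_cderive_Cexp (z : C) : is_cderive Cexp z (Cexp z).
Proof.
  destruct z as [x y].
  assert (Hexp : forall a b, continuity_2d_pt (fun u _ => exp u) a b).
  { intros a b. apply (continuity_1d_2d_pt_comp exp (fun u _ => u)).
    - apply derivable_continuous, derivable_exp.
    - apply continuity_2d_pt_id1. }
  assert (Hc : forall f : R -> R, continuity f ->
    continuous (fun u : R * R => exp (fst u) * f (snd u)) (x, y)).
  { intros f Hf.
    apply (proj1 (continuity_2d_pt_filterlim (fun u v => exp u * f v) x y)).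
    apply continuity_2d_pt_mult; [apply Hexp|].
    apply (continuity_1d_2d_pt_comp f (fun _ v => v)); [apply Hf | apply continuity_2d_pt_id2]. }
  apply is_cderive_differentiable. split.
  - apply filterdiff_differentiable_pt_lim.
    apply (is_derive_filterdiff (fun u v => exp u * cos v) x y
      (fun u v => exp u * cos v) (- (exp x * sin y))).
    + exists (mkposreal 1 Rlt_0_1). intros [a b] _. simpl.
      auto_derive; [exact I | ring].
    + auto_derive; [exact I | ring].
    + apply (Hc cos), continuity_cos.
  - apply filterdiff_differentiable_pt_lim.
    apply (is_derive_filterdiff (fun u v => exp u * sin v) x y
      (fun u v => exp u * sin v) (exp x * cos y)).
    + exists (mkposreal 1 Rlt_0_1). intros [a b] _. simpl.
      auto_derive; [exact I | ring].
    + auto_derive; [exact I | ring].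
    + apply (Hc sin), continuity_sin.
Qed.

Lemma Cexp_plus (z w : C) : Cexp (z + w) = (Cexp z * Cexp w)%C.
Proof.
  destruct z, w. unfold Cexp; simpl. rewrite exp_plus, cos_plus, sin_plus.
  apply injective_projections; simpl; ring.
Qed.

Lemma Cexp_0 : Cexp (RtoC 0) = RtoC 1.
Proof.
  unfold Cexp; simpl. rewrite exp_0, cos_0, sin_0. apply injective_projections; simpl; ring.
Qed.

Lemma Cexp_opp_mul (z : C) : (Cexp z * Cexp (- z))%C = RtoC 1.
Proof. rewrite <- Cexp_plus, Cplus_opp_r. apply Cexp_0. Qed.

Lemma Cexp_opp_inv (z : C) (a : C) : Cexp z = a -> a <> RtoC 0 -> Cexp (- z) = (/ a)%C.
Proof.
  intros E Ha. pose proof (Cexp_opp_mul z) as H. rewrite E in H.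
  rewrite <- (Cmult_1_l (Cexp (- z))), <- (Cinv_l a Ha), <- Cmult_assoc, H. ring.
Qed.

Lemma unit_circle_angle (c s : R) : c * c + s * s = 1 -> exists t, cos t = c /\ sin t = s.
Proof.
  intros H. assert (Hc : -1 <= c <= 1) by nra.
  pose proof (sin_acos c Hc) as Hs. pose proof (cos_acos c Hc) as Hcos.
  unfold Rsqr in Hs. replace (1 - c * c) with (s * s) in Hs by lra.
  destruct (Rle_dec 0 s).
  - exists (acos c). split; [exact Hcos|]. rewrite Hs. apply sqrt_square; assumption.
  - exists (- acos c). rewrite cos_neg, sin_neg. split; [exact Hcos|].
    rewrite Hs. replace (s * s) with (- s * - s) by ring. rewrite sqrt_square; lra.
Qed.

Lemma Cexp_surjective (a : C) : a <> RtoC 0 -> exists z, Cexp z = a.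
Proof.
  intros Ha. pose proof (proj1 (Cmod_gt_0 a) Ha) as Hm.
  pose proof (Cmod2_alt a) as H2. destruct a as [x y]; simpl Re in H2; simpl Im in H2.
  destruct (unit_circle_angle (x / Cmod (x, y)) (y / Cmod (x, y))) as (t & Hc & Hs).
  - replace (x / Cmod (x, y) * (x / Cmod (x, y)) + y / Cmod (x, y) * (y / Cmod (x, y)))
      with ((x ^ 2 + y ^ 2) / (Cmod (x, y) ^ 2)) by (field; lra).
    rewrite <- H2. field. lra.
  - exists (ln (Cmod (x, y)), t). unfold Cexp; simpl. rewrite exp_ln, Hc, Hs by exact Hm.
    f_equal; field; lra.
Qed.

Lemma is_cderive_Cexp_affine (a b z : C) :
  is_cderive (fun w => Cexp (a * w + b))%C z (a * Cexp (a * z + b))%C.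
Proof.
  eapply is_cderive_eq.
  - apply (is_cderive_comp Cexp (fun w => a * w + b)%C); [apply is_cderive_Cexp|].
    apply (is_cderive_plus (fun w => a * w)%C (fun _ => b)); [|apply is_cderive_const].
    apply is_cderive_scal, is_cderive_id.
  - cbv beta; ring.
Qed.

Lemma linear_ode_Cexp (f : C -> C) (a : C) :
  (forall z, is_cderive f z (a * f z)%C) ->
  exists c, forall z, f z = (c * Cexp (a * z))%C.
Proof.
  intros H. exists (f (RtoC 0)). intro z.
  (* The product with the inverse exponential is constant; the summand [RtoC 0] gives the exponent
     the shape of [is_cderive_Cexp_affine]. *)
  assert (K : (f z * Cexp (- a * z + RtoC 0))%C = (f (RtoC 0) * Cexp (- a * RtoC 0 + RtoC 0))%C).
  { apply (plane_const_of_cderive_zero (fun w => f w * Cexp (- a * w + RtoC 0)))%C.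
    intro w. eapply is_cderive_eq.
    - apply is_cderive_mult; [apply H | apply is_cderive_Cexp_affine].
    - cbv beta; ring. }
  replace (- a * RtoC 0 + RtoC 0)%C with (RtoC 0) in K by ring.
  replace (- a * z + RtoC 0)%C with (- (a * z))%C in K by ring.
  rewrite Cexp_0, Cmult_1_r in K. rewrite <- K, <- Cmult_assoc.
  rewrite (Cmult_comm (Cexp _)), Cexp_opp_mul. ring.
Qed.

Lemma cderive_const_affine (f : C -> C) (a : C) :
  (forall z, is_cderive f z a) -> exists c, forall z, f z = (a * z + c)%C.
Proof.
  intros H. exists (f (RtoC 0)). intro z.
  assert (K : (f z - a * z)%C = (f (RtoC 0) - a * RtoC 0)%C).
  { apply (plane_const_of_cderive_zero (fun w => f w - a * w)%C). intro w.
    eapply is_cderive_eq.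
    - apply is_cderive_minus; [apply H | apply is_cderive_scal, is_cderive_id].
    - cbv beta; ring. }
  replace (f z) with ((f z - a * z) + a * z)%C by ring. rewrite K. ring.
Qed.

Definition Ccosh (z : C) : C := ((Cexp z + Cexp (- z)) / RtoC 2)%C.
Definition Csinh (z : C) : C := ((Cexp z - Cexp (- z)) / RtoC 2)%C.

Lemma RtoC_neq_0 (x : R) : x <> 0 -> RtoC x <> RtoC 0.
Proof. intros H E. apply H. injection E. auto. Qed.

Lemma Re0_imaginary (c : C) : Re c = 0 -> exists s : R, c = (Ci * RtoC s)%C.
Proof.
  destruct c as [x y]; simpl; intros ->. exists y. apply injective_projections; simpl; ring.
Qed.

Lemma Csqr_Ci : (Ci * Ci)%C = (- RtoC 1)%C.
Proof. apply injective_projections; simpl; ring. Qed.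

Lemma RtoC_2_neq_0 : RtoC 2 <> RtoC 0.
Proof. apply RtoC_neq_0; lra. Qed.

(* The parameter origin absorbs the ratio of the two constants of integration. *)
Lemma exponential_pair (a b : C) (s : R) :
  s <> 0 -> a <> RtoC 0 ->
  exists w, a = (RtoC s * Cexp w)%C /\ b = (a * b / RtoC s * Cexp (- w))%C.
Proof.
  intros Hs Ha. assert (Hs1 : RtoC s <> RtoC 0) by (apply RtoC_neq_0, Hs).
  destruct (Cexp_surjective (a / RtoC s)%C) as [w Hw].
  { intros E. apply Ha. replace a with (a / RtoC s * RtoC s)%C by (field; exact Hs1).
    rewrite E. ring. }
  assert (Ea : a = (RtoC s * Cexp w)%C) by (rewrite Hw; field; exact Hs1).
  exists w. split; [exact Ea|].
  assert (E : Cexp w <> RtoC 0) by (intro E; apply Ha; rewrite Ea, E; ring).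
  rewrite (Cexp_opp_inv w _ eq_refl E), Ea. field. split; assumption.
Qed.

(** The rotation is diagonalized by [f1 + i f2] and [f1 - i f2], with eigenvalues [i] and [- i].
    Their product is [f3^2] by isotropy, so the two constants of integration satisfy
    [a * b = (i s)^2 = - s^2]. *)
Lemma elliptic_ode_solution (f1 f2 f3 : C -> C) :
  (forall z, is_cderive f1 z (- f2 z)%C) -> (forall z, is_cderive f2 z (f1 z)) ->
  (forall z, is_cderive f3 z (RtoC 0)) ->
  (forall z, (f1 z * f1 z + f2 z * f2 z - f3 z * f3 z)%C = RtoC 0) ->
  (forall z, Re (f3 z) = 0) -> ~ (forall z, f3 z = RtoC 0) ->
  exists (s : R) (b : C), s <> 0 /\ forall z,
    f1 z = (RtoC s * Csinh (Ci * z + b))%C /\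
    f2 z = (- Ci * RtoC s * Ccosh (Ci * z + b))%C /\
    f3 z = (Ci * RtoC s)%C.
Proof.
  intros H1 H2 H3 Hiso HRe Hne.
  pose proof (plane_const_of_cderive_zero f3 H3) as Hc.
  destruct (Re0_imaginary (f3 (RtoC 0)) (HRe _)) as [s Hs].
  assert (Hs0 : s <> 0).
  { intros ->. apply Hne. intro z. rewrite Hc, Hs. ring. }
  assert (Hs1 : RtoC s <> RtoC 0) by (apply RtoC_neq_0, Hs0).
  destruct (linear_ode_Cexp (fun z => f1 z + Ci * f2 z)%C Ci) as [a Ha].
  { intro z. eapply is_cderive_eq.
    - apply is_cderive_plus; [apply H1 | apply is_cderive_scal, H2].
    - replace (Ci * (f1 z + Ci * f2 z))%C with (Ci * f1 z + (Ci * Ci) * f2 z)%C by ring.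
      rewrite Csqr_Ci. ring. }
  destruct (linear_ode_Cexp (fun z => f1 z - Ci * f2 z)%C (- Ci)%C) as [b Hb].
  { intro z. eapply is_cderive_eq.
    - apply is_cderive_minus; [apply H1 | apply is_cderive_scal, H2].
    - replace (- Ci * (f1 z - Ci * f2 z))%C with (- Ci * f1 z + (Ci * Ci) * f2 z)%C by ring.
      rewrite Csqr_Ci. ring. }
  assert (Hab : (a * b)%C = (- (RtoC s * RtoC s))%C).
  { pose proof (Hiso (RtoC 0)) as K. rewrite Hs in K.
    pose proof (Ha (RtoC 0)) as Ka. pose proof (Hb (RtoC 0)) as Kb.
    rewrite Cmult_0_r, Cexp_0, Cmult_1_r in Ka, Kb. rewrite <- Ka, <- Kb.
    transitivity ((f1 0 * f1 0 + f2 0 * f2 0 - (Ci * RtoC s) * (Ci * RtoC s))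
      + (- (1) - Ci * Ci) * (f2 0 * f2 0) + (Ci * Ci) * (RtoC s * RtoC s))%C; [ring|].
    rewrite K, Csqr_Ci. ring. }
  assert (Ha0 : a <> RtoC 0).
  { intros ->. apply (Cmult_neq_0 _ _ Hs1 Hs1).
    transitivity (- - (RtoC s * RtoC s))%C; [ring | rewrite <- Hab; ring]. }
  destruct (exponential_pair a b s Hs0 Ha0) as (w & Ea & Eb).
  replace (a * b / RtoC s)%C with (- RtoC s)%C in Eb by (rewrite Hab; field; exact Hs1).
  exists s, w. split; [exact Hs0|]. intro z.
  assert (K1 : (f1 z + Ci * f2 z)%C = (RtoC s * Cexp (Ci * z + w))%C)
    by (rewrite Ha, Ea, Cexp_plus; ring).
  assert (K2 : (f1 z - Ci * f2 z)%C = (- RtoC s * Cexp (- (Ci * z + w)))%C).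
  { rewrite Hb, Eb. replace (- (Ci * z + w))%C with (- Ci * z + - w)%C by ring.
    rewrite Cexp_plus; ring. }
  unfold Csinh, Ccosh. split; [|split].
  - transitivity (((f1 z + Ci * f2 z) + (f1 z - Ci * f2 z)) / RtoC 2)%C;
      [field; apply RtoC_2_neq_0 | rewrite K1, K2; field; apply RtoC_2_neq_0].
  - transitivity (- Ci * (((f1 z + Ci * f2 z) - (f1 z - Ci * f2 z)) / RtoC 2))%C.
    + transitivity (- (Ci * Ci) * f2 z)%C; [rewrite Csqr_Ci; ring | field; apply RtoC_2_neq_0].
    + rewrite K1, K2; field; apply RtoC_2_neq_0.
  - rewrite Hc. exact Hs.
Qed.

(** Here [f2 + f3] and [f2 - f3] diagonalize the boost, with eigenvalues [1] and [-1], and isotropy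
    gives [a * b = - (i s)^2 = s^2]. The argument is written [RtoC 1 * z + b] to share the affine
    form of the elliptic case. *)
Lemma hyperbolic_ode_solution (f1 f2 f3 : C -> C) :
  (forall z, is_cderive f1 z (RtoC 0)) -> (forall z, is_cderive f2 z (f3 z)) ->
  (forall z, is_cderive f3 z (f2 z)) ->
  (forall z, (f1 z * f1 z + f2 z * f2 z - f3 z * f3 z)%C = RtoC 0) ->
  (forall z, Re (f1 z) = 0) -> ~ (forall z, f1 z = RtoC 0) ->
  exists (s : R) (b : C), s <> 0 /\ forall z,
    f1 z = (Ci * RtoC s)%C /\
    f2 z = (RtoC s * Ccosh (RtoC 1 * z + b))%C /\
    f3 z = (RtoC s * Csinh (RtoC 1 * z + b))%C.
Proof.
  intros H1 H2 H3 Hiso HRe Hne.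
  pose proof (plane_const_of_cderive_zero f1 H1) as Hc.
  destruct (Re0_imaginary (f1 (RtoC 0)) (HRe _)) as [s Hs].
  assert (Hs0 : s <> 0).
  { intros ->. apply Hne. intro z. rewrite Hc, Hs. ring. }
  assert (Hs1 : RtoC s <> RtoC 0) by (apply RtoC_neq_0, Hs0).
  destruct (linear_ode_Cexp (fun z => f2 z + f3 z)%C (RtoC 1)) as [a Ha].
  { intro z. eapply is_cderive_eq.
    - apply is_cderive_plus; [apply H2 | apply H3].
    - ring. }
  destruct (linear_ode_Cexp (fun z => f2 z - f3 z)%C (- RtoC 1)%C) as [b Hb].
  { intro z. eapply is_cderive_eq.
    - apply is_cderive_minus; [apply H2 | apply H3].
    - ring. }
  assert (Hab : (a * b)%C = (RtoC s * RtoC s)%C).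
  { pose proof (Hiso (RtoC 0)) as K. rewrite Hs in K.
    pose proof (Ha (RtoC 0)) as Ka. pose proof (Hb (RtoC 0)) as Kb.
    rewrite Cmult_0_r, Cexp_0, Cmult_1_r in Ka, Kb. rewrite <- Ka, <- Kb.
    transitivity (((Ci * RtoC s) * (Ci * RtoC s) + f2 0 * f2 0 - f3 0 * f3 0)
      - (Ci * Ci) * (RtoC s * RtoC s))%C; [ring|].
    rewrite K, Csqr_Ci. ring. }
  assert (Ha0 : a <> RtoC 0).
  { intros ->. rewrite Cmult_0_l in Hab. apply (Cmult_neq_0 _ _ Hs1 Hs1). symmetry; exact Hab. }
  destruct (exponential_pair a b s Hs0 Ha0) as (w & Ea & Eb).
  replace (a * b / RtoC s)%C with (RtoC s)%C in Eb by (rewrite Hab; field; exact Hs1).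
  exists s, w. split; [exact Hs0|]. intro z.
  assert (K1 : (f2 z + f3 z)%C = (RtoC s * Cexp (RtoC 1 * z + w))%C)
    by (rewrite Ha, Ea, Cexp_plus; ring).
  assert (K2 : (f2 z - f3 z)%C = (RtoC s * Cexp (- (RtoC 1 * z + w)))%C).
  { rewrite Hb, Eb. replace (- (RtoC 1 * z + w))%C with (- RtoC 1 * z + - w)%C by ring.
    rewrite Cexp_plus; ring. }
  unfold Csinh, Ccosh. split; [|split].
  - rewrite Hc. exact Hs.
  - transitivity (((f2 z + f3 z) + (f2 z - f3 z)) / RtoC 2)%C;
      [field; apply RtoC_2_neq_0 | rewrite K1, K2; field; apply RtoC_2_neq_0].
  - transitivity (((f2 z + f3 z) - (f2 z - f3 z)) / RtoC 2)%C;
      [field; apply RtoC_2_neq_0 | rewrite K1, K2; field; apply RtoC_2_neq_0].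
Qed.

(** The generator is nilpotent, so the solutions are polynomials: [f3 - f1] is constant, [f2] is
    affine, and isotropy determines [f1 + f3]. *)
Lemma parabolic_ode_solution (f1 f2 f3 : C -> C) :
  (forall z, is_cderive f1 z (f2 z)) -> (forall z, is_cderive f2 z (f3 z - f1 z)%C) ->
  (forall z, is_cderive f3 z (f2 z)) ->
  (forall z, (f1 z * f1 z + f2 z * f2 z - f3 z * f3 z)%C = RtoC 0) ->
  (forall z, Re (f3 z - f1 z)%C = 0) -> ~ (forall z, (f3 z - f1 z)%C = RtoC 0) ->
  exists (s : R) (b : C), s <> 0 /\ forall z,
    let w := (z + b)%C in
    f1 z = (Ci * RtoC s * ((w * w - RtoC 1) / RtoC 2))%C /\
    f2 z = (Ci * RtoC s * w)%C /\
    f3 z = (Ci * RtoC s * ((w * w + RtoC 1) / RtoC 2))%C.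
Proof.
  intros H1 H2 H3 Hiso HRe Hne.
  assert (Hc : forall z, (f3 z - f1 z)%C = (f3 (RtoC 0) - f1 (RtoC 0))%C).
  { apply (plane_const_of_cderive_zero (fun z => f3 z - f1 z)%C). intro z.
    eapply is_cderive_eq; [apply is_cderive_minus; [apply H3 | apply H1] | ring]. }
  destruct (Re0_imaginary _ (HRe (RtoC 0))) as [s Hs].
  assert (Hd : forall z, (f3 z - f1 z)%C = (Ci * RtoC s)%C) by (intro; rewrite Hc; exact Hs).
  assert (Hs0 : s <> 0).
  { intros ->. apply Hne. intro z. rewrite Hd. ring. }
  set (d := (Ci * RtoC s)%C) in *.
  assert (Hd0 : d <> RtoC 0) by (apply Cmult_neq_0; [apply Ci_nz | apply RtoC_neq_0, Hs0]).
  destruct (cderive_const_affine f2 d) as [e He].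
  { intro z. eapply is_cderive_eq; [apply H2 | apply Hd]. }
  exists s, (e / d)%C. split; [exact Hs0|]. intro z. cbv zeta. fold d.
  assert (E2 : f2 z = (d * (z + e / d))%C) by (rewrite He; field; exact Hd0).
  (* The isotropy condition reads [f2^2 = d (f1 + f3)]. *)
  assert (Es : (f1 z + f3 z)%C = (d * ((z + e / d) * (z + e / d)))%C).
  { transitivity (((f1 z * f1 z + f2 z * f2 z - f3 z * f3 z)
      + (f3 z - f1 z) * (f1 z + f3 z)) / d)%C.
    - rewrite Hiso, Hd. field. exact Hd0.
    - replace ((f1 z * f1 z + f2 z * f2 z - f3 z * f3 z) + (f3 z - f1 z) * (f1 z + f3 z))%C
        with (f2 z * f2 z)%C by ring.
      rewrite E2. field. exact Hd0. }
  split; [|split].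
  - transitivity (((f1 z + f3 z) - (f3 z - f1 z)) / RtoC 2)%C; [field; apply RtoC_2_neq_0|].
    rewrite Es, Hd. generalize (z + e / d)%C. intro w. field.
  - exact E2.
  - transitivity (((f1 z + f3 z) + (f3 z - f1 z)) / RtoC 2)%C; [field; apply RtoC_2_neq_0|].
    rewrite Es, Hd. generalize (z + e / d)%C. intro w. field.
Qed.

(** * The model surfaces *)

Lemma holomorphic_plane_of_is_cderive (f f' : C -> C) :
  (forall z, is_cderive f z (f' z)) -> holomorphic_on plane f.
Proof. intros H z _. exists (f' z). apply H. Qed.

Lemma continuous_C_pair {T : UniformSpace} (f g : T -> R) (x : T) :
  continuous f x -> continuous g x -> continuous (fun t => (f t, g t) : C) x.
Proof.
  intros Hf Hg. apply filterlim_locally. intro eps.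
  pose proof (proj1 (filterlim_locally f (f x)) Hf eps) as H1.
  pose proof (proj1 (filterlim_locally g (g x)) Hg eps) as H2.
  apply (filter_imp _ _ (fun t H => H) (filter_and _ _ H1 H2)).
Qed.

Lemma plane_simply_connected : simply_connected_domain plane.
Proof.
  split; [|split; [|split]].
  - intros z _. exists (mkposreal 1 Rlt_0_1). intros w _. exact I.
  - exists (RtoC 0). exact I.
  - intros [x y] [x' y'] _ _.
    exists (fun t => (x + t * (x' - x), y + t * (y' - y))). split; [|split; [|split]].
    + intro t. apply continuous_C_pair;
        apply (ex_derive_continuous (K := R_AbsRing) (V := R_NormedModule)); auto_derive; exact I.
    + intros; exact I.
    + f_equal; ring.
    + f_equal; ring.
  - intros g Hg _ Hloop.
    exists (fun st => (RtoC (1 - fst st) * g (snd st))%C), (RtoC 0).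
    split; [|split; [|split; [|split]]].
    + intros [s t].
      assert (H1 : forall (p : C -> R), (forall z, continuous p z) ->
        continuous (fun st : R * R => (1 - fst st) * p (g (snd st))) (s, t)).
      { intros p Hp. apply (continuous_mult (K := R_AbsRing)).
        - apply (continuous_minus (V := R_NormedModule) (fun _ => 1) (fun st : R * R => fst st)).
          + apply continuous_const.
          + apply continuous_fst.
        - apply (continuous_comp (fun st : R * R => g (snd st)) p); [|apply Hp].
          apply (continuous_comp (fun st : R * R => snd st) g); [apply continuous_snd | apply Hg]. }
      apply (continuous_ext (fun st : R * R => ((1 - fst st) * fst (g (snd st)), (1 - fst st) * snd (g (snd st))) : C)).
      * intros [a b]. apply injective_projections; simpl; ring.
      * apply continuous_C_pair.
        -- apply (H1 (fun z => fst z)). intros [a b]; apply continuous_fst.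
        -- apply (H1 (fun z => snd z)). intros [a b]; apply continuous_snd.
    + intros; exact I.
    + intros t _. simpl. rewrite Rminus_0_r. apply Cmult_1_l.
    + intros t _. simpl. rewrite Rminus_diag. apply Cmult_0_l.
    + intros s _. simpl. rewrite Hloop. reflexivity.
Qed.

Lemma is_cderive_ext (f g : C -> C) (z l : C) :
  (forall w, f w = g w) -> is_cderive f z l -> is_cderive g z l.
Proof. apply (is_derive_ext (K := C_AbsRing) (V := C_NormedModule)). Qed.

Definition Re3 (p : C3) : R3 := V3 (Re (c1 p)) (Re (c2 p)) (Re (c3 p)).

Definition is_cderive3 (G : C -> C3) (z : C) (l : C3) : Prop :=
  is_cderive (fun w => c1 (G w)) z (c1 l) /\ is_cderive (fun w => c2 (G w)) z (c2 l) /\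
  is_cderive (fun w => c3 (G w)) z (c3 l).

Lemma isotropic_Re3 (D : C -> Prop) (G phi : C -> C3) :
  (forall z, D z -> is_cderive3 G z (phi z)) ->
  is_isotropic_curve (Surface D (fun z => Re3 (G z))) phi.
Proof.
  intros H z Hz. destruct (H z Hz) as (H1 & H2 & H3). split; [|split]; apply is_twice_dz_Re.
  - exact H1.
  - exact H2.
  - exact H3.
Qed.

Lemma is_cderive_Ccosh (z : C) : is_cderive Ccosh z (Csinh z).
Proof.
  unfold Ccosh, Csinh.
  apply (is_cderive_ext
    (fun w => / RtoC 2 * (Cexp (RtoC 1 * w + RtoC 0) + Cexp (- RtoC 1 * w + RtoC 0)))%C).
  { intro w. replace (RtoC 1 * w + RtoC 0)%C with w by ring.
    replace (- RtoC 1 * w + RtoC 0)%C with (- w)%C by ring.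
    change ((/ RtoC 2 * (Cexp w + Cexp (- w)))%C = ((Cexp w + Cexp (- w)) / RtoC 2)%C).
    unfold Cdiv; ring. }
  eapply is_cderive_eq.
  - apply is_cderive_scal. apply is_cderive_plus; apply is_cderive_Cexp_affine.
  - replace (RtoC 1 * z + RtoC 0)%C with z by ring.
    replace (- RtoC 1 * z + RtoC 0)%C with (- z)%C by ring. unfold Cdiv; ring.
Qed.

Lemma is_cderive_Csinh (z : C) : is_cderive Csinh z (Ccosh z).
Proof.
  unfold Ccosh, Csinh.
  apply (is_cderive_ext
    (fun w => / RtoC 2 * (Cexp (RtoC 1 * w + RtoC 0) - Cexp (- RtoC 1 * w + RtoC 0)))%C).
  { intro w. replace (RtoC 1 * w + RtoC 0)%C with w by ring.
    replace (- RtoC 1 * w + RtoC 0)%C with (- w)%C by ring.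
    change ((/ RtoC 2 * (Cexp w - Cexp (- w)))%C = ((Cexp w - Cexp (- w)) / RtoC 2)%C).
    unfold Cdiv; ring. }
  eapply is_cderive_eq.
  - apply is_cderive_scal. apply is_cderive_minus; apply is_cderive_Cexp_affine.
  - replace (RtoC 1 * z + RtoC 0)%C with z by ring.
    replace (- RtoC 1 * z + RtoC 0)%C with (- z)%C by ring. unfold Cdiv; ring.
Qed.

Lemma is_cderive_affine (a b z : C) : is_cderive (fun w => a * w + b)%C z a.
Proof.
  eapply is_cderive_eq.
  - apply (is_cderive_plus (fun w => a * w)%C (fun _ => b)); [|apply is_cderive_const].
    apply is_cderive_scal, is_cderive_id.
  - cbv beta; ring.
Qed.

Lemma weierstrass_isotropic (g w : C -> C) (z : C) :
  let p := weierstrass 1 g w z in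
  (c1 p * c1 p + c2 p * c2 p + RtoC 1 * (c3 p * c3 p))%C = RtoC 0.
Proof.
  cbv zeta. unfold weierstrass; simpl.
  transitivity ((RtoC (1 / 2) * RtoC (1 / 2) *
     ((1 - g z * g z) * (1 - g z * g z) + (Ci * Ci) * ((1 + g z * g z) * (1 + g z * g z)))
     + g z * g z) * (w z * w z))%C; [ring|].
  rewrite Csqr_Ci.
  replace (RtoC (1 / 2)) with (/ RtoC 2)%C by (apply injective_projections; simpl; field).
  field.
Qed.

Lemma holomorphic_weierstrass (g w : C -> C) :
  holomorphic_on plane g -> holomorphic_on plane w ->
  holomorphic_on plane (fun z => c1 (weierstrass 1 g w z)) /\
  holomorphic_on plane (fun z => c2 (weierstrass 1 g w z)) /\
  holomorphic_on plane (fun z => c3 (weierstrass 1 g w z)).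
Proof.
  intros Hg Hw.
  assert (Hgg : forall z, exists l, is_cderive (fun z => RtoC 1 * (g z * g z))%C z l).
  { intro z. eexists. apply is_cderive_scal.
    apply is_cderive_mult; apply (holomorphic_is_cderive _ _ z Hg I). }
  repeat split; intros z _; destruct (Hgg z) as [l Hl];
    pose proof (holomorphic_is_cderive _ _ z Hw I) as Kw;
    pose proof (holomorphic_is_cderive _ _ z Hg I) as Kg; eexists; simpl.
  - apply is_cderive_mult; [|exact Kw]. apply is_cderive_scal.
    apply is_cderive_minus; [apply is_cderive_const | exact Hl].
  - apply is_cderive_mult; [|exact Kw]. apply is_cderive_scal.
    apply is_cderive_plus; [apply is_cderive_const | exact Hl].
  - apply is_cderive_mult; [exact Kg | exact Kw].
Qed.

Lemma minimal_on_plane_Re3 (g w : C -> C) (G : C -> C3) :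
  holomorphic_on plane g -> holomorphic_on plane w ->
  (forall z, is_cderive3 G z (weierstrass 1 g w z)) ->
  (exists z, c3 (weierstrass 1 g w z) <> RtoC 0 \/ c1 (weierstrass 1 g w z) <> RtoC 0) ->
  minimal_on_plane g w (Surface plane (fun z => Re3 (G z))).
Proof.
  intros Hg Hw HG [z Hz]. split; [intro; reflexivity|].
  destruct (holomorphic_weierstrass g w Hg Hw) as (W1 & W2 & W3).
  split; [exact plane_simply_connected|].
  split; [apply isotropic_Re3; intros; apply HG|].
  split; [exact W1|]. split; [exact W2|]. split; [exact W3|]. split.
  - intros u _. apply weierstrass_isotropic.
  - exists z. split; [exact I|].
    destruct Hz as [Hz | Hz]; apply Cmod_gt_0 in Hz;
      pose proof (pow2_ge_0 (Cmod (c1 (weierstrass 1 g w z))));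
      pose proof (pow2_ge_0 (Cmod (c2 (weierstrass 1 g w z))));
      pose proof (pow2_ge_0 (Cmod (c3 (weierstrass 1 g w z)))); nra.
Qed.

(** For [z = x + i y] the real part is [(- cosh x cos y, - cosh x sin y, x)]: a circle of radius
    [cosh x] at height [x]. *)
Definition catenoid_primitive (z : C) : C3 := V3 (- Ccosh z)%C (Ci * Csinh z)%C z.

Definition catenoid_model : surface := Surface plane (fun z => Re3 (catenoid_primitive z)).

Lemma standard_catenoid_model : standard_catenoid catenoid_model.
Proof.
  assert (Hw : holomorphic_on plane (fun z => Cexp (- z)%C)).
  { apply (holomorphic_plane_of_is_cderive _ (fun z => (- RtoC 1) * Cexp (- RtoC 1 * z + RtoC 0))%C).
    intro z. apply (is_cderive_ext
      (fun w => Cexp (- RtoC 1 * w + RtoC 0)%C)); [intro w; f_equal; ring|].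
    apply is_cderive_Cexp_affine. }
  assert (H12 : RtoC (1 / 2) = (/ RtoC 2)%C) by (apply injective_projections; simpl; field).
  apply minimal_on_plane_Re3.
  - apply (holomorphic_plane_of_is_cderive _ Cexp), is_cderive_Cexp.
  - exact Hw.
  - intro z. unfold weierstrass. rewrite H12. split; [|split]; simpl.
    + eapply is_cderive_eq; [apply is_cderive_opp, is_cderive_Ccosh|].
      unfold Csinh. pose proof (Cexp_opp_mul z) as E.
      transitivity (/ RtoC 2 * (Cexp (- z) - Cexp z * (Cexp z * Cexp (- z))))%C;
        [rewrite E; unfold Cdiv; ring | ring].
    + eapply is_cderive_eq; [apply is_cderive_scal, is_cderive_Csinh|].
      unfold Ccosh. pose proof (Cexp_opp_mul z) as E.
      transitivity (Ci * / RtoC 2 * (Cexp (- z) + Cexp z * (Cexp z * Cexp (- z))))%C;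
        [rewrite E; unfold Cdiv; ring | ring].
    + eapply is_cderive_eq; [apply is_cderive_id|]. symmetry; apply Cexp_opp_mul.
  - exists (RtoC 0). left. simpl. rewrite Cexp_opp_mul. apply RtoC_neq_0; lra.
Qed.

Definition enneper_primitive (z : C) : C3 :=
  V3 ((z - z * (z * z) / RtoC 3) / RtoC 2)%C (Ci * ((z + z * (z * z) / RtoC 3) / RtoC 2))%C
     (z * z / RtoC 2)%C.

Definition enneper_model : surface := Surface plane (fun z => Re3 (enneper_primitive z)).

Lemma is_cderive_cube_third (z : C) :
  is_cderive (fun w => w * (w * w) / RtoC 3)%C z (z * z)%C.
Proof.
  eapply is_cderive_eq.
  - apply is_cderive_mult; [|apply is_cderive_const].
    apply is_cderive_mult; [apply is_cderive_id|].
    apply is_cderive_mult; apply is_cderive_id.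
  - cbv beta. field.
Qed.

Lemma is_cderive_enneper_primitive (z : C) :
  is_cderive3 enneper_primitive z (weierstrass 1 (fun z => z) (fun _ => RtoC 1) z).
Proof.
  assert (H12 : RtoC (1 / 2) = (/ RtoC 2)%C) by (apply injective_projections; simpl; field).
  unfold weierstrass. rewrite H12. split; [|split]; simpl.
  - eapply is_cderive_eq.
    + apply is_cderive_mult; [|apply is_cderive_const].
      apply is_cderive_minus; [apply is_cderive_id | apply is_cderive_cube_third].
    + cbv beta; ring.
  - eapply is_cderive_eq.
    + apply is_cderive_scal. apply is_cderive_mult; [|apply is_cderive_const].
      apply is_cderive_plus; [apply is_cderive_id | apply is_cderive_cube_third].
    + cbv beta; ring.
  - eapply is_cderive_eq.
    + apply is_cderive_mult; [|apply is_cderive_const].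
      apply is_cderive_mult; apply is_cderive_id.
    + cbv beta; field.
Qed.

Lemma standard_enneper_model : standard_enneper enneper_model.
Proof.
  apply minimal_on_plane_Re3.
  - apply (holomorphic_plane_of_is_cderive _ (fun _ => RtoC 1)), is_cderive_id.
  - apply (holomorphic_plane_of_is_cderive _ (fun _ => RtoC 0)). intro; apply is_cderive_const.
  - exact is_cderive_enneper_primitive.
  - exists (RtoC 1). left. simpl. rewrite Cmult_1_l. apply RtoC_neq_0; lra.
Qed.

(** * Conformal changes of parameter of the plane *)

Lemma reparametrization_affine (a b : C) :
  a <> RtoC 0 -> reparametrization plane plane (fun z => a * z + b)%C.
Proof.
  intros Ha. exists (fun w => / a * w + - b / a)%C. split; [|split].
  - intros z _. split; [exact I|]. field. exact Ha.
  - intros w _. split; [exact I|]. field. exact Ha.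
  - left. split; intros z _; eexists; apply is_cderive_affine.
Qed.

Lemma reparametrization_conj_affine (a b : C) :
  a <> RtoC 0 -> reparametrization plane plane (fun z => Cconj (a * z + b)%C).
Proof.
  intros Ha. exists (fun w => / a * Cconj w + - b / a)%C. split; [|split].
  - intros z _. split; [exact I|]. rewrite Cconj_conj. field. exact Ha.
  - intros w _. split; [exact I|].
    replace (a * (/ a * Cconj w + - b / a) + b)%C with (Cconj w) by (field; exact Ha).
    apply Cconj_conj.
  - right. split; intros z _; eexists.
    + apply (is_cderive_ext (fun z => a * z + b)%C).
      * intro w. symmetry. apply Cconj_conj.
      * apply is_cderive_affine.
    + apply (is_cderive_conj (fun w => / a * w + - b / a)%C). apply is_cderive_affine.
Qed.

Lemma Cexp_conj (z : C) : Cexp (Cconj z) = Cconj (Cexp z).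
Proof.
  destruct z as [x y]. unfold Cexp; simpl. rewrite cos_neg, sin_neg.
  apply injective_projections; simpl; ring.
Qed.

Lemma Cexp_plus_iPI (z : C) : Cexp (z + Ci * RtoC PI) = (- Cexp z)%C.
Proof.
  rewrite Cexp_plus. unfold Cexp at 2. simpl.
  replace (0 * PI - 1 * 0) with 0 by ring. replace (0 * 0 + 1 * PI) with PI by ring.
  rewrite exp_0, cos_PI, sin_PI. destruct (Cexp z). apply injective_projections; simpl; ring.
Qed.

Lemma Cexp_minus_iPI (z : C) : Cexp (- (z + Ci * RtoC PI)) = (- Cexp (- z))%C.
Proof.
  transitivity (- - Cexp (- (z + Ci * RtoC PI)))%C; [ring|]. rewrite <- Cexp_plus_iPI.
  f_equal. f_equal. ring.
Qed.

(** * The dual surface *)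

(* The primitive of [(sinh, - i cosh, 1)]. For [s < 0] the model is traversed with the
   opposite orientation. *)
Lemma scaled_catenoid (A : R3 -> R3) (s : R) (a b : C) :
  (forall r p, A (scal3 r p) = scal3 r (A p)) -> s <> 0 -> a <> RtoC 0 ->
  same_surface_via A
    (Surface plane (fun z => A (Re3 (V3 (RtoC s * Ccosh (a * z + b))
       (RtoC s * (- Ci * Csinh (a * z + b))) (RtoC s * (a * z + b)))%C)))
    catenoid_model.
Proof.
  intros HA Hs Ha. destruct (Rlt_dec 0 s) as [Hpos | Hneg].
  (* The model has the opposite signs in its first two coordinates. Adding [i PI] to the parameter,
     a half turn about the axis, reverses them and keeps the height. *)
  - exists (fun z => a * z + (b + Ci * RtoC PI))%C, s, zero3.
    split; [apply reparametrization_affine, Ha|]. split; [exact Hpos|].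
    intros z _. simpl pos. rewrite <- HA.
    replace (a * z + (b + Ci * RtoC PI))%C with ((a * z + b) + Ci * RtoC PI)%C by ring.
    generalize (a * z + b)%C. intro w.
    unfold catenoid_primitive, Ccosh, Csinh. rewrite Cexp_plus_iPI, Cexp_minus_iPI.
    replace (Re3 _) with
      (scal3 s (Re3 (V3 (- ((- Cexp w + - Cexp (- w)) / RtoC 2))
        (Ci * ((- Cexp w - - Cexp (- w)) / RtoC 2)) (w + Ci * RtoC PI))%C)).
    + destruct (A _) as [x y t]. unfold add3, zero3; simpl. f_equal; ring.
    + cbv [Re3 scal3 c1 c2 c3]. rewrite !re_scal_l.
      replace (- ((- Cexp w + - Cexp (- w)) / RtoC 2))%C
        with ((Cexp w + Cexp (- w)) / RtoC 2)%C by (unfold Cdiv; ring).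
      replace (Ci * ((- Cexp w - - Cexp (- w)) / RtoC 2))%C
        with (- Ci * ((Cexp w - Cexp (- w)) / RtoC 2))%C by (unfold Cdiv; ring).
      replace (Re (w + Ci * RtoC PI)%C) with (Re w) by (simpl; unfold Re; ring). reflexivity.
  (* With the positive factor [- s] all signs would be reversed. The first two are already opposite
     in the model; replacing [x + i y] by [- x + i y] reverses the height and keeps these two
     coordinates. *)
  - exists (fun z => Cconj (- a * z + - b)%C), (- s), zero3.
    split; [apply reparametrization_conj_affine|].
    { intros E. apply Ha. transitivity (- - a)%C; [ring | rewrite E; ring]. }
    split; [lra|].
    intros z _. simpl pos. rewrite <- HA.
    replace (- a * z + - b)%C with (- (a * z + b))%C by ring.
    generalize (a * z + b)%C. intro w.
    assert (E : forall u, Cexp (- Cconj u) = Cconj (Cexp (- u))).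
    { intro u. rewrite <- Cexp_conj. f_equal. }
    replace (Re3 _) with (scal3 (- s) (Re3 (catenoid_primitive (Cconj (- w))))).
    + destruct (A _) as [x y t]. unfold add3, zero3; simpl. f_equal; ring.
    + cbv [Re3 scal3 c1 c2 c3 catenoid_primitive Ccosh Csinh].
      rewrite E, Cexp_conj. replace (- - w)%C with w by ring.
      assert (H2 : (/ RtoC 2)%C = RtoC (/ 2)) by (apply injective_projections; simpl; field).
      unfold Cdiv. rewrite H2.
      destruct (Cexp w), (Cexp (- w)), w. f_equal; simpl; ring.
Qed.

(** In terms of Enneper's coordinates [(E1, E2, E3)] the given primitive is [s * (E1, - E3, E2)],
    for [s > 0] a quarter turn about the first axis. The rotation depends on the sign of [s], hence
    the existential. *)
Lemma scaled_enneper (s : R) (b : C) :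
  s <> 0 -> exists A, euclidean_rotation A /\
  same_surface_via A
    (Surface plane (fun z => let w := (z + b)%C in
       Re3 (V3 (RtoC s * ((w - w * (w * w) / RtoC 3) / RtoC 2)) (RtoC s * - (w * w / RtoC 2))
         (RtoC s * (Ci * ((w + w * (w * w) / RtoC 3) / RtoC 2))))%C))
    enneper_model.
Proof.
  intros Hs.
  assert (H2 : (/ RtoC 2)%C = RtoC (/ 2)) by (apply injective_projections; simpl; field).
  assert (H3 : (/ RtoC 3)%C = RtoC (/ 3)) by (apply injective_projections; simpl; field).
  destruct (Rlt_dec 0 s) as [Hpos | Hneg].
  - exists (fun p => V3 (c1 p) (- c3 p) (c2 p)). split.
    { split; [intros p q; unfold dot3; simpl; ring | unfold det3; simpl; ring]. }
    exists (fun z => RtoC 1 * z + b)%C, s, zero3.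
    split; [apply reparametrization_affine, RtoC_neq_0; lra|]. split; [exact Hpos|].
    intros z _. simpl pos. rewrite Cmult_1_l. generalize (z + b)%C. intros [x y].
    cbv [Re3 enneper_primitive add3 scal3 zero3 c1 c2 c3 Cdiv].
    rewrite H2, H3. f_equal; simpl; ring.
  - (* Enneper's surface in the parameter [i w] is a rotation of its opposite. *)
    exists (fun p => V3 (c2 p) (- c3 p) (- c1 p)). split.
    { split; [intros p q; unfold dot3; simpl; ring | unfold det3; simpl; ring]. }
    exists (fun z => Ci * z + Ci * b)%C, (- s), zero3.
    split; [apply reparametrization_affine, Ci_nz|]. split; [lra|].
    intros z _. simpl pos.
    replace (Ci * z + Ci * b)%C with (Ci * (z + b))%C by ring.
    generalize (z + b)%C. intros [x y].
    cbv [Re3 enneper_primitive add3 scal3 zero3 c1 c2 c3 Cdiv].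
    rewrite H2, H3. f_equal; simpl; ring.
Qed.

Lemma reparametrization_comp_holomorphic (D D' : C -> Prop) (h k eta : C -> C) :
  (forall z, D' z <-> D z) ->
  (forall z, D (h z) /\ k (h z) = z) -> (forall w, D w -> h (k w) = w) ->
  holomorphic_on plane h -> holomorphic_on D k ->
  reparametrization plane plane eta -> reparametrization D' plane (fun w => eta (k w)).
Proof.
  intros HD Hh Hk hhol khol (eta' & E1 & E2 & E3).
  exists (fun z => h (eta' z)). split; [|split].
  - intros w Hw. split; [exact I|].
    rewrite (proj2 (E1 (k w) I)). apply Hk, HD, Hw.
  - intros z _. split; [apply HD, Hh|].
    rewrite (proj2 (Hh (eta' z))). apply E2, I.
  - assert (Kk : forall w, D' w -> is_cderive k w (C_derive k w))
      by (intros w Hw; apply (holomorphic_is_cderive D); [exact khol | apply HD, Hw]).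
    assert (Kh : forall z, is_cderive h z (C_derive h z))
      by (intro z; apply (holomorphic_is_cderive plane); [exact hhol | exact I]).
    destruct E3 as [[F1 F2] | [F1 F2]]; [left | right]; split.
    + intros w Hw. eexists. apply is_cderive_comp; [|apply Kk, Hw].
      apply (holomorphic_is_cderive plane); [exact F1 | exact I].
    + intros z _. eexists. apply is_cderive_comp; [apply Kh|].
      apply (holomorphic_is_cderive plane); [exact F2 | exact I].
    + intros w Hw. eexists. apply (is_cderive_comp (fun u => Cconj (eta u))); [|apply Kk, Hw].
      apply (holomorphic_is_cderive plane (fun u => Cconj (eta u))); [exact F1 | exact I].
    + intros z _. eexists.
      (* A double conjugation splits the map into two holomorphic factors: [h] conjugated on both
         sides, and the conjugate of [eta']. *)
      apply (is_cderive_ext (fun u => Cconj (h (Cconj (Cconj (eta' u)))))).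
      * intro w. rewrite Cconj_conj. reflexivity.
      * apply (is_cderive_comp (fun v => Cconj (h (Cconj v))) (fun u => Cconj (eta' u))).
        -- apply is_cderive_conj, Kh.
        -- apply (holomorphic_is_cderive plane (fun u => Cconj (eta' u))); [exact F2 | exact I].
Qed.

Section Dual.
Variables (M : surface) (psi : C -> C3) (h k : C -> C).
Hypothesis Mmax : maximal_with M psi.
Hypothesis Hh : forall z, dom M (h z) /\ k (h z) = z.
Hypothesis Hk : forall w, dom M w -> h (k w) = w.
Hypothesis hhol : holomorphic_on plane h.
Hypothesis khol : holomorphic_on (dom M) k.

(** The isotropic curve of [M] in the parameter [h], by the chain rule. *)
Definition pull (z : C) : C3 :=
  V3 (C_derive h z * c1 (psi (h z)))%C (C_derive h z * c2 (psi (h z)))%C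
     (C_derive h z * c3 (psi (h z)))%C.

Let Mopen : open (dom M).
Proof. apply Mmax. Qed.

Lemma pull_harmonic :
  harmonic_with (fun z => c1 (pos M (h z))) (fun z => c1 (pull z)) /\
  harmonic_with (fun z => c2 (pos M (h z))) (fun z => c2 (pull z)) /\
  harmonic_with (fun z => c3 (pos M (h z))) (fun z => c3 (pull z)).
Proof.
  destruct Mmax as (_ & Hi & H1 & H2 & H3 & _).
  split; [|split]; simpl.
  - apply (harmonic_pullback (dom M) h Mopen (fun z => proj1 (Hh z)) hhol
      (fun w => c1 (pos M w)) (fun w => c1 (psi w))); [intros w Hw; apply Hi, Hw | exact H1].
  - apply (harmonic_pullback (dom M) h Mopen (fun z => proj1 (Hh z)) hhol
      (fun w => c2 (pos M w)) (fun w => c2 (psi w))); [intros w Hw; apply Hi, Hw | exact H2].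
  - apply (harmonic_pullback (dom M) h Mopen (fun z => proj1 (Hh z)) hhol
      (fun w => c3 (pos M w)) (fun w => c3 (psi w))); [intros w Hw; apply Hi, Hw | exact H3].
Qed.

Lemma pull_isotropic (z : C) :
  (c1 (pull z) * c1 (pull z) + c2 (pull z) * c2 (pull z) - c3 (pull z) * c3 (pull z))%C = RtoC 0.
Proof.
  destruct Mmax as (_ & _ & _ & _ & _ & Hiso & _).
  pose proof (Hiso (h z) (proj1 (Hh z))) as E. unfold pull; simpl.
  transitivity (C_derive h z * C_derive h z * (c1 (psi (h z)) * c1 (psi (h z))
    + c2 (psi (h z)) * c2 (psi (h z)) + RtoC (-1) * (c3 (psi (h z)) * c3 (psi (h z)))))%C.
  - replace (RtoC (-1)) with (- RtoC 1)%C by (apply injective_projections; simpl; ring). ring.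
  - rewrite E. ring.
Qed.

Lemma planar_of_const (n : R3) (d : R) :
  n <> zero3 -> (forall z, dot3 n (pos M (h z)) = d) -> planar M.
Proof.
  intros Hn Hd. exists n, d. split; [exact Hn|]. intros w Hw. rewrite <- (Hk w Hw). apply Hd.
Qed.

Section Primitive.
Variable G : C -> C3.
Hypothesis HG : forall z, is_cderive3 G z (dual_curve pull z).

(** The real part of [G], carried back to the given domain by [k]. The factors [k'] and [h'] from
    the chain rule cancel, which leaves the dual of [psi] itself. *)
Lemma dual_exists : exists M', is_dual M M'.
Proof.
  destruct Mmax as (Hsc & Hi & H1 & H2 & H3 & Hiso & Hne).
  exists (Surface (dom M) (fun w => Re3 (G (k w)))).
  split; [intro; reflexivity|]. exists psi. split; [exact Mmax|].
  assert (Hinv : forall w, dom M w -> (C_derive k w * C_derive h (k w))%C = RtoC 1)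
    by (intros w Hw; apply (inverse_derivative (dom M) h Mopen hhol); assumption).
  split; [exact Hsc|]. split.
  { apply (isotropic_Re3 (dom M) (fun w => G (k w))). intros w Hw.
    pose proof (holomorphic_is_cderive (dom M) k w khol Hw) as Kk.
    destruct (HG (k w)) as (G1 & G2 & G3).
    unfold dual_curve, pull in G1, G2, G3; simpl in G1, G2, G3. rewrite (Hk w Hw) in G1, G2, G3.
    pose proof (Hinv w Hw) as E.
    split; [|split]; simpl.
    - eapply is_cderive_eq; [apply (is_cderive_comp (fun v => c1 (G v))); [exact G1 | exact Kk]|].
      transitivity (C_derive k w * C_derive h (k w) * (Ci * c1 (psi w)))%C; [ring | rewrite E; ring].
    - eapply is_cderive_eq; [apply (is_cderive_comp (fun v => c2 (G v))); [exact G2 | exact Kk]|].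
      transitivity (C_derive k w * C_derive h (k w) * (Ci * c2 (psi w)))%C; [ring | rewrite E; ring].
    - eapply is_cderive_eq; [apply (is_cderive_comp (fun v => c3 (G v))); [exact G3 | exact Kk]|].
      transitivity (C_derive k w * C_derive h (k w) * c3 (psi w))%C; [ring | rewrite E; ring]. }
  simpl dom. unfold dual_curve; simpl c1; simpl c2; simpl c3.
  split; [|split; [|split; [|split]]].
  - intros w Hw. eexists. apply is_cderive_scal, (holomorphic_is_cderive _ _ w H1 Hw).
  - intros w Hw. eexists. apply is_cderive_scal, (holomorphic_is_cderive _ _ w H2 Hw).
  - exact H3.
  - intros w Hw. pose proof (Hiso w Hw) as E.
    transitivity ((Ci * Ci) * (c1 (psi w) * c1 (psi w) + c2 (psi w) * c2 (psi w))
      + RtoC 1 * (c3 (psi w) * c3 (psi w)))%C; [ring|]. rewrite Csqr_Ci.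
    transitivity (- (c1 (psi w) * c1 (psi w) + c2 (psi w) * c2 (psi w)
      + RtoC (-1) * (c3 (psi w) * c3 (psi w))))%C; [|rewrite E; ring].
    replace (RtoC (-1)) with (- RtoC 1)%C by (apply injective_projections; simpl; ring). ring.
  (* If the Euclidean sum of squares vanished, every modulus would vanish, and with them the
     Lorentzian sum. *)
  - destruct Hne as (w & Hw & Hw0). exists w. split; [exact Hw|].
    rewrite !Cmod_mult, Cmod_Ci. intros E. apply Hw0.
    pose proof (pow2_ge_0 (Cmod (c1 (psi w)))). pose proof (pow2_ge_0 (Cmod (c2 (psi w)))).
    pose proof (pow2_ge_0 (Cmod (c3 (psi w)))). rewrite !Rmult_1_l in E. lra.
Qed.

(** The curve used by [is_dual] agrees with [psi] on the domain because partial derivatives are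
    unique. In the plane parameter each coordinate then differs from the real part of [G] by a
    function of zero gradient, and the plane is connected. *)
Lemma dual_unique (M' : surface) :
  is_dual M M' ->
  exists t, forall w, dom M' w -> pos M' w = add3 (Re3 (G (k w))) t.
Proof.
  intros (HD & psi' & M1 & M2).
  destruct Mmax as (_ & Hi & H1 & H2 & H3 & _).
  destruct M1 as (_ & Hi' & _).
  destruct M2 as (_ & Hd & _).
  assert (E : forall w, dom M w -> c1 (psi' w) = c1 (psi w) /\ c2 (psi' w) = c2 (psi w)
    /\ c3 (psi' w) = c3 (psi w)).
  { intros w Hw. destruct (Hi w Hw) as (P1 & P2 & P3). destruct (Hi' w Hw) as (Q1 & Q2 & Q3).
    split; [|split]; eapply is_twice_dz_unique; eassumption. }
  assert (Key : forall (f : C -> R) (q Gj : C -> C),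
    (forall w, dom M w -> is_twice_dz f w (q w)) -> holomorphic_on (dom M) q ->
    (forall z, is_cderive Gj z (C_derive h z * q (h z))%C) ->
    exists t, forall w, dom M w -> f w = Re (Gj (k w)) + t).
  { intros f q Gj Hf Hq HGj.
    destruct (harmonic_pullback (dom M) h Mopen (fun z => proj1 (Hh z)) hhol f q Hf Hq) as [Hz _].
    assert (K : forall z, f (h z) + (-1) * Re (Gj z) = f (h (RtoC 0)) + (-1) * Re (Gj (RtoC 0))).
    { apply (plane_const_of_dz_zero (fun z => f (h z) + (-1) * Re (Gj z))). intro z.
      replace (RtoC 0) with (C_derive h z * q (h z) + RtoC (-1) * (C_derive h z * q (h z)))%C
        by (apply injective_projections; simpl; ring).
      apply (is_twice_dz_plus (fun z => f (h z)) (fun z => (-1) * Re (Gj z))); [apply Hz|].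
      apply is_twice_dz_scal, is_twice_dz_Re, HGj. }
    exists (f (h (RtoC 0)) + (-1) * Re (Gj (RtoC 0))). intros w Hw.
    rewrite <- (K (k w)), (Hk w Hw). ring. }
  destruct (Key (fun w => c1 (pos M' w)) (fun w => Ci * c1 (psi w))%C (fun z => c1 (G z)))
    as [t1 T1].
  { intros w Hw. rewrite <- (proj1 (E w Hw)). apply (Hd w), HD, Hw. }
  { intros w Hw. eexists. apply is_cderive_scal, (holomorphic_is_cderive _ _ w H1 Hw). }
  { intro z. apply (is_cderive_eq _ _ _ _ (proj1 (HG z))). simpl; ring. }
  destruct (Key (fun w => c2 (pos M' w)) (fun w => Ci * c2 (psi w))%C (fun z => c2 (G z)))
    as [t2 T2].
  { intros w Hw. rewrite <- (proj1 (proj2 (E w Hw))). apply (Hd w), HD, Hw. }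
  { intros w Hw. eexists. apply is_cderive_scal, (holomorphic_is_cderive _ _ w H2 Hw). }
  { intro z. apply (is_cderive_eq _ _ _ _ (proj1 (proj2 (HG z)))). simpl; ring. }
  destruct (Key (fun w => c3 (pos M' w)) (fun w => c3 (psi w))%C (fun z => c3 (G z)))
    as [t3 T3].
  { intros w Hw. rewrite <- (proj2 (proj2 (E w Hw))). apply (Hd w), HD, Hw. }
  { exact H3. }
  { intro z. apply (is_cderive_eq _ _ _ _ (proj2 (proj2 (HG z)))). simpl; ring. }
  exists (V3 t1 t2 t3). intros w Hw. apply HD in Hw.
  specialize (T1 w Hw). specialize (T2 w Hw). specialize (T3 w Hw). simpl in T1, T2, T3.
  destruct (pos M' w). simpl in T1, T2, T3. subst. reflexivity.
Qed.

Lemma dual_same_surface (A : R3 -> R3) (P S M' : surface) :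
  is_dual M M' -> same_surface_via A P S ->
  dom P = plane -> dom S = plane ->
  (forall z, pos P z = Re3 (G z)) -> same_surface_via A M' S.
Proof.
  intros HM' (eta & lambda & t & Heta & Hl & Hpos) EP ES HP.
  destruct (dual_unique M' HM') as [t' Ht'].
  rewrite EP in Heta, Hpos. rewrite ES in Heta.
  exists (fun w => eta (k w)), lambda, (add3 t t'). split; [|split; [exact Hl|]].
  - rewrite ES. apply (reparametrization_comp_holomorphic (dom M) _ h); try assumption.
    apply HM'.
  - intros w Hw. rewrite (Ht' w Hw), <- HP, (Hpos (k w) I).
    unfold add3; simpl. f_equal; ring.
Qed.
End Primitive.
End Dual.

(** This is how nonplanarity enters: if the invariant coordinate had zero derivative, the surface
    would lie in one of its level planes. *)
Lemma not_identically_zero (f : C -> R) (p : C -> C) :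
  (forall z, is_twice_dz f z (p z)) -> ~ (exists d, forall z, f z = d) ->
  ~ (forall z, p z = RtoC 0).
Proof.
  intros Hf Hn H0. apply Hn. exists (f (RtoC 0)).
  apply plane_const_of_dz_zero. intro w. rewrite <- (H0 w). apply Hf.
Qed.

(** * The three kinds of catenoid *)

Ltac derive_at_0 :=
  auto_derive; [exact I | rewrite ?cos_0, ?sin_0; field].

Lemma elliptic_dual (M : surface) :
  lorentz_catenoid Elliptic M ->
  (exists M', is_dual M M') /\
  (forall M', is_dual M M' -> euclidean_catenoid (axis_dir Elliptic) M').
Proof.
  intros ([psi Mmax] & Hnp & Hrot).
  destruct (rotational_holomorphic _ _ Hrot) as (h & k & [p1 p2 p3] & Hh & Hk & hhol & khol & Hcov).
  destruct (pull_harmonic M psi h k Mmax Hh hhol) as (P1 & P2 & P3).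
  pose proof (pull_isotropic M psi h k Mmax Hh) as Piso.
  assert (W1 : forall z t, c1 (pos M (h (z + RtoC t)%C)) =
    (p1 - cos t * p1 + sin t * p2) + cos t * c1 (pos M (h z))
      + - sin t * c2 (pos M (h z)) + 0 * c3 (pos M (h z))).
  { intros z t. rewrite Hcov. simpl. ring. }
  assert (W2 : forall z t, c2 (pos M (h (z + RtoC t)%C)) =
    (p2 - sin t * p1 - cos t * p2) + sin t * c1 (pos M (h z))
      + cos t * c2 (pos M (h z)) + 0 * c3 (pos M (h z))).
  { intros z t. rewrite Hcov. simpl. ring. }
  assert (W3 : forall z t, c3 (pos M (h (z + RtoC t)%C)) =
    0 + 0 * c1 (pos M (h z)) + 0 * c2 (pos M (h z)) + 1 * c3 (pos M (h z))).
  { intros z t. rewrite Hcov. simpl. ring. }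
  destruct (elliptic_ode_solution (fun z => c1 (pull psi h z)) (fun z => c2 (pull psi h z))
    (fun z => c3 (pull psi h z))) as (s & b & Hs & Hf).
  - intro z. apply (is_cderive_eq _ _ (RtoC 0 * c1 (pull psi h z) + RtoC (-1) * c2 (pull psi h z)
        + RtoC 0 * c3 (pull psi h z))%C); [|apply injective_projections; simpl; ring].
    apply (harmonic_covariance _ _ _ _ _ _ _ _ (fun t => p1 - cos t * p1 + sin t * p2)
      cos (fun t => - sin t) (fun _ => 0)
      _ _ _ P1 P1 P2 P3); [derive_at_0 | derive_at_0 | derive_at_0 | exact W1].
  - intro z. apply (is_cderive_eq _ _ (RtoC 1 * c1 (pull psi h z) + RtoC 0 * c2 (pull psi h z)
        + RtoC 0 * c3 (pull psi h z))%C); [|ring].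
    apply (harmonic_covariance _ _ _ _ _ _ _ _ (fun t => p2 - sin t * p1 - cos t * p2)
      sin cos (fun _ => 0)
      _ _ _ P2 P1 P2 P3); [derive_at_0 | derive_at_0 | derive_at_0 | exact W2].
  - intro z. apply (is_cderive_eq _ _ (RtoC 0 * c1 (pull psi h z) + RtoC 0 * c2 (pull psi h z)
        + RtoC 0 * c3 (pull psi h z))%C); [|ring].
    apply (harmonic_covariance _ _ _ _ _ _ _ _ (fun _ => 0) (fun _ => 0) (fun _ => 0) (fun _ => 1)
      _ _ _ P3 P1 P2 P3); [derive_at_0 | derive_at_0 | derive_at_0 | exact W3].
  - exact Piso.
  - apply (dz_invariant_Re _ _ (proj1 P3)). intros z t. rewrite W3. ring.
  - apply (not_identically_zero _ _ (proj1 P3)). intros [d Hd]. apply Hnp.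
    apply (planar_of_const M h k Hk (V3 0 0 1) d).
    + intros E. injection E. lra.
    + intro z. rewrite <- (Hd z). unfold dot3; simpl. ring.
  (* The constants of integration are chosen so that [G] depends on [Ci * z + b] alone, as in
     [scaled_catenoid]. *)
  - set (G := fun z => (V3 (RtoC s * Ccosh (Ci * z + b))
       (RtoC s * (- Ci * Csinh (Ci * z + b))) (RtoC s * (Ci * z + b)))%C).
    assert (HG : forall z, is_cderive3 G z (dual_curve (pull psi h) z)).
    { intro z. destruct (Hf z) as (F1 & F2 & F3). unfold dual_curve. rewrite F1, F2, F3.
      split; [|split]; simpl.
      - eapply is_cderive_eq.
        + apply is_cderive_scal.
          apply (is_cderive_comp Ccosh (fun w => Ci * w + b)%C);
            [apply is_cderive_Ccosh | apply is_cderive_affine].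
        + ring.
      - eapply is_cderive_eq.
        + apply is_cderive_scal, is_cderive_scal.
          apply (is_cderive_comp Csinh (fun w => Ci * w + b)%C);
            [apply is_cderive_Csinh | apply is_cderive_affine].
        + ring.
      - eapply is_cderive_eq; [apply is_cderive_scal, is_cderive_affine | ring]. }
    split; [exact (dual_exists M psi h k Mmax Hk hhol khol G HG)|].
    intros M' HM'. exists catenoid_model, (fun p => p).
    split; [exact standard_catenoid_model|].
    split; [split; [reflexivity | unfold det3; simpl; ring]|]. split; [reflexivity|].
    refine (dual_same_surface M psi h k Mmax Hh Hk hhol khol G HG _ _ _ M' HM'
      (scaled_catenoid (fun p => p) s Ci b (fun _ _ => eq_refl) Hs Ci_nz) eq_refl eq_refl
      (fun _ => eq_refl)).
Qed.

Lemma hyperbolic_dual (M : surface) :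
  lorentz_catenoid Hyperbolic M ->
  (exists M', is_dual M M') /\
  (forall M', is_dual M M' -> euclidean_catenoid (axis_dir Hyperbolic) M').
Proof.
  intros ([psi Mmax] & Hnp & Hrot).
  destruct (rotational_holomorphic _ _ Hrot) as (h & k & [p1 p2 p3] & Hh & Hk & hhol & khol & Hcov).
  destruct (pull_harmonic M psi h k Mmax Hh hhol) as (P1 & P2 & P3).
  pose proof (pull_isotropic M psi h k Mmax Hh) as Piso.
  assert (W1 : forall z t, c1 (pos M (h (z + RtoC t)%C)) =
    0 + 1 * c1 (pos M (h z)) + 0 * c2 (pos M (h z)) + 0 * c3 (pos M (h z))).
  { intros z t. rewrite Hcov. simpl. ring. }
  assert (W2 : forall z t, c2 (pos M (h (z + RtoC t)%C)) =
    (p2 - cosh t * p2 - sinh t * p3) + 0 * c1 (pos M (h z))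
      + cosh t * c2 (pos M (h z)) + sinh t * c3 (pos M (h z))).
  { intros z t. rewrite Hcov. simpl. ring. }
  assert (W3 : forall z t, c3 (pos M (h (z + RtoC t)%C)) =
    (p3 - sinh t * p2 - cosh t * p3) + 0 * c1 (pos M (h z))
      + sinh t * c2 (pos M (h z)) + cosh t * c3 (pos M (h z))).
  { intros z t. rewrite Hcov. simpl. ring. }
  assert (Dcosh : is_derive cosh 0 0)
    by (apply is_derive_Reals; rewrite <- sinh_0 at 2; apply derivable_pt_lim_cosh).
  assert (Dsinh : is_derive sinh 0 1)
    by (apply is_derive_Reals; rewrite <- cosh_0; apply derivable_pt_lim_sinh).
  destruct (hyperbolic_ode_solution (fun z => c1 (pull psi h z)) (fun z => c2 (pull psi h z))
    (fun z => c3 (pull psi h z))) as (s & b & Hs & Hf).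
  - intro z. apply (is_cderive_eq _ _ (RtoC 0 * c1 (pull psi h z) + RtoC 0 * c2 (pull psi h z)
        + RtoC 0 * c3 (pull psi h z))%C); [|ring].
    apply (harmonic_covariance _ _ _ _ _ _ _ _ (fun _ => 0) (fun _ => 1) (fun _ => 0) (fun _ => 0)
      _ _ _ P1 P1 P2 P3); [derive_at_0 | derive_at_0 | derive_at_0 | exact W1].
  - intro z. apply (is_cderive_eq _ _ (RtoC 0 * c1 (pull psi h z) + RtoC 0 * c2 (pull psi h z)
        + RtoC 1 * c3 (pull psi h z))%C); [|ring].
    apply (harmonic_covariance _ _ _ _ _ _ _ _ (fun t => p2 - cosh t * p2 - sinh t * p3)
      (fun _ => 0) cosh sinh
      _ _ _ P2 P1 P2 P3); [derive_at_0 | exact Dcosh | exact Dsinh | exact W2].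
  - intro z. apply (is_cderive_eq _ _ (RtoC 0 * c1 (pull psi h z) + RtoC 1 * c2 (pull psi h z)
        + RtoC 0 * c3 (pull psi h z))%C); [|ring].
    apply (harmonic_covariance _ _ _ _ _ _ _ _ (fun t => p3 - sinh t * p2 - cosh t * p3)
      (fun _ => 0) sinh cosh
      _ _ _ P3 P1 P2 P3); [derive_at_0 | exact Dsinh | exact Dcosh | exact W3].
  - exact Piso.
  - apply (dz_invariant_Re _ _ (proj1 P1)). intros z t. rewrite W1. ring.
  - apply (not_identically_zero _ _ (proj1 P1)). intros [d Hd]. apply Hnp.
    apply (planar_of_const M h k Hk (V3 1 0 0) d).
    + intros E. injection E. lra.
    + intro z. rewrite <- (Hd z). unfold dot3; simpl. ring.
  - set (w := fun z => (RtoC 1 * z + b)%C).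
    (* The dual curve is [(- s, i s cosh w, s sinh w)]. Its primitive is written with [- s] so that
       it is literally the image under [A] below of the primitive in [scaled_catenoid]. *)
    set (G := fun z => (V3 (RtoC (- s) * w z) (RtoC (- s) * (- Ci * Csinh (w z)))
      (- (RtoC (- s) * Ccosh (w z))))%C).
    assert (HG : forall z, is_cderive3 G z (dual_curve (pull psi h) z)).
    { intro z. destruct (Hf z) as (F1 & F2 & F3). unfold dual_curve. rewrite F1, F2, F3.
      fold (w z). assert (Es : RtoC (- s) = (- RtoC s)%C) by (apply injective_projections; simpl; ring).
      unfold G. rewrite Es. split; [|split]; simpl.
      - eapply is_cderive_eq; [apply is_cderive_scal, is_cderive_affine|].
        transitivity ((Ci * Ci) * RtoC s)%C; [rewrite Csqr_Ci; ring | ring].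
      - eapply is_cderive_eq.
        + apply is_cderive_scal, is_cderive_scal.
          apply (is_cderive_comp Csinh w); [apply is_cderive_Csinh | apply is_cderive_affine].
        + ring.
      - eapply is_cderive_eq.
        + apply is_cderive_opp, is_cderive_scal.
          apply (is_cderive_comp Ccosh w); [apply is_cderive_Ccosh | apply is_cderive_affine].
        + ring. }
    split; [exact (dual_exists M psi h k Mmax Hk hhol khol G HG)|].
    (* A quarter turn about the second axis, taking the axis [e3] of the model to [e1]. *)
    set (A := fun p : R3 => V3 (c3 p) (c2 p) (- c1 p)).
    assert (HA : forall r p, A (scal3 r p) = scal3 r (A p)).
    { intros r p. unfold A, scal3; simpl. f_equal. ring. }
    intros M' HM'. exists catenoid_model, A.
    split; [exact standard_catenoid_model|].
    split; [split; [intros p q; unfold dot3, A; simpl; ring | unfold det3, A; simpl; ring]|].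
    split; [unfold A; simpl; f_equal; ring|].
    refine (dual_same_surface M psi h k Mmax Hh Hk hhol khol G HG _ _ _ M' HM'
      (scaled_catenoid A (- s) (RtoC 1) b HA (Ropp_neq_0_compat s Hs) (RtoC_neq_0 1 R1_neq_R0))
      eq_refl eq_refl (fun _ => eq_refl)).
Qed.

Lemma parabolic_dual (M : surface) :
  lorentz_catenoid Parabolic M ->
  (exists M', is_dual M M') /\ (forall M', is_dual M M' -> enneper_surface M').
Proof.
  intros ([psi Mmax] & Hnp & Hrot).
  destruct (rotational_holomorphic _ _ Hrot) as (h & k & [p1 p2 p3] & Hh & Hk & hhol & khol & Hcov).
  destruct (pull_harmonic M psi h k Mmax Hh hhol) as (P1 & P2 & P3).
  pose proof (pull_isotropic M psi h k Mmax Hh) as Piso.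
  assert (W1 : forall z t, c1 (pos M (h (z + RtoC t)%C)) =
    (p1 - (1 - t ^ 2 / 2) * p1 - t * p2 - t ^ 2 / 2 * p3) + (1 - t ^ 2 / 2) * c1 (pos M (h z))
      + t * c2 (pos M (h z)) + t ^ 2 / 2 * c3 (pos M (h z))).
  { intros z t. rewrite Hcov. simpl. ring. }
  assert (W2 : forall z t, c2 (pos M (h (z + RtoC t)%C)) =
    (t * p1 - t * p3) + - t * c1 (pos M (h z)) + 1 * c2 (pos M (h z)) + t * c3 (pos M (h z))).
  { intros z t. rewrite Hcov. simpl. ring. }
  assert (W3 : forall z t, c3 (pos M (h (z + RtoC t)%C)) =
    (p3 + t ^ 2 / 2 * p1 - t * p2 - (1 + t ^ 2 / 2) * p3) + - (t ^ 2 / 2) * c1 (pos M (h z))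
      + t * c2 (pos M (h z)) + (1 + t ^ 2 / 2) * c3 (pos M (h z))).
  { intros z t. rewrite Hcov. simpl. ring. }
  (* [x3 - x1] is, up to sign, the Lorentz product with [(1, 0, 1)]; it is the coordinate invariant
     under the parabolic rotations. *)
  assert (P31 : forall z, is_twice_dz (fun z => c3 (pos M (h z)) + -1 * c1 (pos M (h z))) z
    (c3 (pull psi h z) - c1 (pull psi h z))%C).
  { intro z. replace (c3 (pull psi h z) - c1 (pull psi h z))%C
      with (c3 (pull psi h z) + RtoC (-1) * c1 (pull psi h z))%C
      by (apply injective_projections; simpl; ring).
    apply (is_twice_dz_plus (fun z => c3 (pos M (h z))) (fun z => -1 * c1 (pos M (h z))));
      [apply P3 | apply is_twice_dz_scal, P1]. }
  destruct (parabolic_ode_solution (fun z => c1 (pull psi h z)) (fun z => c2 (pull psi h z))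
    (fun z => c3 (pull psi h z))) as (s & b & Hs & Hf).
  - intro z. apply (is_cderive_eq _ _ (RtoC 0 * c1 (pull psi h z) + RtoC 1 * c2 (pull psi h z)
        + RtoC 0 * c3 (pull psi h z))%C); [|ring].
    apply (harmonic_covariance _ _ _ _ _ _ _ _
      (fun t => p1 - (1 - t ^ 2 / 2) * p1 - t * p2 - t ^ 2 / 2 * p3) (fun t => 1 - t ^ 2 / 2) (fun t => t)
      (fun t => t ^ 2 / 2) _ _ _ P1 P1 P2 P3);
      [derive_at_0 | derive_at_0 | derive_at_0 | exact W1].
  - intro z. apply (is_cderive_eq _ _ (RtoC (-1) * c1 (pull psi h z) + RtoC 0 * c2 (pull psi h z)
        + RtoC 1 * c3 (pull psi h z))%C); [|apply injective_projections; simpl; ring].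
    apply (harmonic_covariance _ _ _ _ _ _ _ _ (fun t => t * p1 - t * p3)
      (fun t => - t) (fun _ => 1) (fun t => t)
      _ _ _ P2 P1 P2 P3); [derive_at_0 | derive_at_0 | derive_at_0 | exact W2].
  - intro z. apply (is_cderive_eq _ _ (RtoC 0 * c1 (pull psi h z) + RtoC 1 * c2 (pull psi h z)
        + RtoC 0 * c3 (pull psi h z))%C); [|ring].
    apply (harmonic_covariance _ _ _ _ _ _ _ _
      (fun t => p3 + t ^ 2 / 2 * p1 - t * p2 - (1 + t ^ 2 / 2) * p3) (fun t => - (t ^ 2 / 2)) (fun t => t)
      (fun t => 1 + t ^ 2 / 2) _ _ _ P3 P1 P2 P3);
      [derive_at_0 | derive_at_0 | derive_at_0 | exact W3].
  - exact Piso.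
  - apply (dz_invariant_Re _ _ P31). intros z t. rewrite W1, W3. ring.
  - apply (not_identically_zero _ _ P31). intros [d Hd]. apply Hnp.
    apply (planar_of_const M h k Hk (V3 (-1) 0 1) d).
    + intros E. injection E. lra.
    + intro z. rewrite <- (Hd z). unfold dot3; simpl. ring.
  (* The dual curve is [s * ((1 - w^2) / 2, - w, i (1 + w^2) / 2)], that is, Enneper's curve with
     its last two components exchanged and one sign changed. *)
  - set (G := fun z => let w := (z + b)%C in
       (V3 (RtoC s * ((w - w * (w * w) / RtoC 3) / RtoC 2)) (RtoC s * - (w * w / RtoC 2))
         (RtoC s * (Ci * ((w + w * (w * w) / RtoC 3) / RtoC 2))))%C).
    assert (HG : forall z, is_cderive3 G z (dual_curve (pull psi h) z)).
    { intro z. destruct (Hf z) as (F1 & F2 & F3). unfold dual_curve. rewrite F1, F2, F3.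
      destruct (is_cderive_enneper_primitive (z + b)%C) as (E1 & E2 & E3).
      unfold weierstrass in E1, E2, E3; simpl in E1, E2, E3.
      apply is_cderive_shift in E1. apply is_cderive_shift in E2. apply is_cderive_shift in E3.
      assert (H12 : RtoC (1 / 2) = (/ RtoC 2)%C) by (apply injective_projections; simpl; field).
      rewrite H12 in E1, E2.
      split; [|split]; simpl.
      - eapply is_cderive_eq; [apply is_cderive_scal, E1|].
        transitivity ((Ci * Ci) * (RtoC s * (((z + b) * (z + b) - RtoC 1) / RtoC 2)))%C;
          [rewrite Csqr_Ci; unfold Cdiv; ring | ring].
      - eapply is_cderive_eq; [apply is_cderive_scal, is_cderive_opp, E3|].
        transitivity ((Ci * Ci) * (RtoC s * (z + b)))%C; [rewrite Csqr_Ci; ring | ring].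
      - eapply is_cderive_eq; [apply is_cderive_scal, E2|].
        unfold Cdiv; ring. }
    split; [exact (dual_exists M psi h k Mmax Hk hhol khol G HG)|].
    intros M' HM'. destruct (scaled_enneper s b Hs) as (A & HA & HAs).
    exists enneper_model, A.
    split; [exact standard_enneper_model|]. split; [exact HA|].
    exact (dual_same_surface M psi h k Mmax Hh Hk hhol khol G HG _ _ _ M' HM'
      HAs eq_refl eq_refl (fun _ => eq_refl)).
Qed.

Theorem proposition4p1 :
  (forall (a : axis) (M : surface),
     a = Elliptic \/ a = Hyperbolic ->
     lorentz_catenoid a M ->
     (exists M', is_dual M M') /\
     (forall M', is_dual M M' -> euclidean_catenoid (axis_dir a) M')) /\
  (forall M : surface,
     lorentz_catenoid Parabolic M ->
     (exists M', is_dual M M') /\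
     (forall M', is_dual M M' -> enneper_surface M')).
Proof.
  split.
  - intros a M [-> | ->].
    + apply elliptic_dual.
    + apply hyperbolic_dual.
  - exact parabolic_dual.
Qed.
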